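(* For all non-constant dominants $f,g$ of the universal cover $\mathcal A$ of $U(n)$, the relative growth satisfies $\gamma(f,g)=\mu(g)/\mu(f)$.
   Context: $\mathcal A$: homotopy classes rel endpoints of paths $u:[0,1]\to U(n)$, $u(0)=I$, with $\dot uu^{-1}=ih_u(t)$, $h_u$ Hermitian. Order: $f\ge g$ iff $fg^{-1}$ has a representative with $h(t)$ positive semidefinite for all $t$. Dominants: elements with a representative having $h_u(t)$ positive definite for all $t$. $\gamma_n(f,g)=\inf\{p\in\mathbb Z:f^p\ge g^n\}$, $\gamma(f,g)=\lim_{n\to\infty}\gamma_n(f,g)/n$. $\mu(u)=\theta(1)-\theta(0)$ with $\theta$ continuous, $\det u(t)=e^{i\theta(t)}$ (positive on dominants). *)

(* Defs.v *)
From HB Require Import structures.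
From mathcomp Require Import all_boot all_order all_algebra.
From mathcomp Require Import complex.
From mathcomp Require Import all_classical all_reals all_analysis.
Set Implicit Arguments. Unset Strict Implicit. Unset Printing Implicit Defensive.
Import Order.TTheory GRing.Theory Num.Theory.
Import numFieldNormedType.Exports.
Local Open Scope ring_scope.
Local Open Scope classical_set_scope.

Section UnitaryCover.
Variables (R : realType) (n : nat).

Local Notation C := (complex.complex R).
Local Notation M := ('M[C]_n).

(* A candidate path / homotopy is just a map R -> M; only its values on
   [0,1] matter (except for the smoothness requirement, see is_C1). *)
Definition mpath := R -> M.

Definition adjmx (m p : nat) (A : 'M[C]_(m, p)) : 'M[C]_(p, m) :=
  (map_mx (@complex.conjc R) A)^T.

Definition unitary (A : M) : Prop := A *m adjmx A = 1%:M.

Definition I01 : set R := `[0, 1]%classic.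

Definition is_path (u : mpath) : Prop :=
  [/\ u 0 = 1%:M,
      (forall t, I01 t -> unitary (u t)) &
      (forall i j, {within I01, continuous (fun t => complex.Re (u t i j))} /\
                   {within I01, continuous (fun t => complex.Im (u t i j))})].

Definition homotopic (u v : mpath) : Prop :=
  is_path u /\ is_path v /\
  exists H : R -> R -> M,
    [/\ (forall i j,
           {within I01 `*` I01, continuous (fun p : R * R => complex.Re (H p.1 p.2 i j))} /\
           {within I01 `*` I01, continuous (fun p : R * R => complex.Im (H p.1 p.2 i j))}),
        (forall s t, I01 s -> I01 t -> unitary (H s t)),
        (forall t, I01 t -> H 0 t = u t /\ H 1 t = v t) &
        (forall s, I01 s -> H s 0 = u 0 /\ H s 1 = u 1)].

Definition is_C1 (u : mpath) : Prop :=
  forall i j,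
    (forall t, derivable (fun s => complex.Re (u s i j)) t 1) /\
    (forall t, derivable (fun s => complex.Im (u s i j)) t 1) /\
    continuous (fun s => complex.Re (u s i j))^`() /\
    continuous (fun s => complex.Im (u s i j))^`().

Definition mderiv (u : mpath) (t : R) : M :=
  \matrix_(i, j) complex.Complex ((fun s => complex.Re (u s i j))^`() t)
                                  ((fun s => complex.Im (u s i j))^`() t).

(* h_u(t) defined by  u'(t) u(t)^{-1} = i h_u(t)  (u(t)^{-1} = u(t)^* ) *)
Definition hgen (u : mpath) (t : R) : M :=
  (- complex.Complex 0 1) *: (mderiv u t *m adjmx (u t)).

Definition hermitian (A : M) : Prop := adjmx A = A.

Definition psd (A : M) : Prop :=
  hermitian A /\ forall v : 'cV[C]_n, 0 <= (adjmx v *m A *m v) 0 0.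

Definition pd (A : M) : Prop :=
  hermitian A /\ forall v : 'cV[C]_n, v != 0 -> 0 < (adjmx v *m A *m v) 0 0.

(* group operations on paths (pointwise); they descend to the universal cover *)
Definition pmul (u v : mpath) : mpath := fun t => u t *m v t.
Definition pinv (u : mpath) : mpath := fun t => adjmx (u t).
Definition mxnpow (A : M) (k : nat) : M := iter k (mulmx A) 1%:M.
Definition ppow (u : mpath) (p : int) : mpath :=
  fun t => match p with
           | Posz k => mxnpow (u t) k
           | Negz k => mxnpow (adjmx (u t)) k.+1
           end.

Definition const_path : mpath := fun _ => 1%:M.

Definition nonneg (u : mpath) : Prop :=
  exists w, homotopic u w /\ is_C1 w /\ forall t, I01 t -> psd (hgen w t).

Definition geq (f g : mpath) : Prop := nonneg (pmul f (pinv g)).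

Definition dominant (u : mpath) : Prop :=
  exists w, homotopic u w /\ is_C1 w /\ forall t, I01 t -> pd (hgen w t).

Definition det_lift (u : mpath) (theta : R -> R) : Prop :=
  {within I01, continuous theta} /\
  forall t, I01 t -> \det (u t) = complex.Complex (cos (theta t)) (sin (theta t)).

Definition is_gamma_n (f g : mpath) (k : nat) (p : int) : Prop :=
  geq (ppow f p) (ppow g k%:Z) /\
  forall q : int, geq (ppow f q) (ppow g k%:Z) -> p <= q.

End UnitaryCover.

(* Main.v *)
Require Import Defs.
From HB Require Import structures.
From mathcomp Require Import all_boot all_order all_algebra.
From mathcomp Require Import ring lra.
From mathcomp Require Import fingroup perm complex.
From mathcomp Require Import all_classical all_reals all_analysis.
Import Order.TTheory GRing.Theory Num.Theory.
Import numFieldNormedType.Exports.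
Local Open Scope ring_scope.
Local Open Scope classical_set_scope.
Set Implicit Arguments. Unset Strict Implicit. Unset Printing Implicit Defensive.

(** Lower bound: the determinant winding number [mu] is additive and homotopy
    invariant, and Jacobi's formula makes the lift of [det w] nondecreasing
    when [h_w] is positive semidefinite; so [f^p >= g^k] forces
    [p mu(f) >= k mu(g)].

    Upper bound: every path is homotopic to some [t |-> V diag(e^(i t b_j)) V^*].
    Away from the branch points where [-e^(ic)] is an eigenvalue of [A], the
    Cayley transform contracts [A] to [1] continuously in [A]; comparing
    [t |-> u (s t)] with this contraction at [A = u s] gives a loop which varies
    continuously with [s], so that the property propagates along [0, 1].  Loops
    [V diag(e^(2 pi i m_j t)) V^*] only depend on the sum of the [m_j], by
    rotating eigenlines into one another, so the [b_j] can all be made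
    nonnegative once their sum [mu] is at least [2 pi n].  Hence [f^p >= g^k] as
    soon as [p mu(f) - k mu(g) >= 2 pi n], an error that disappears in the
    limit.  *)

(** The group $U(n)$ has no continuous logarithm: eigenvalues collide, and an eigenbasis cannot in
    general be followed along a path. The spectral theorem is therefore applied to one matrix at a
    time only, while whatever must vary continuously with a matrix $A$ is a rational function of
    $A$. No single contraction serves for all of $U(n)$, which is not contractible for $n \ge 1$;
    hence the branch parameter $c$, which changes as the path proceeds, and the comparison loop,
    which records the cost of each change in multiples of $2\pi$. The normal form $V e^{itb} V^{-1}$
    is useful because its generator $h$ is constant with eigenvalues $b_j$, so that positivity
    becomes $b_j \ge 0$. For $n \ge 2$ the sum of the $b_j$ alone does not decide the order. The
    constant $2\pi n$ is the price of reducing angles modulo $2\pi$: each of the $n$ angles costs at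
    most one turn. *)

Lemma within_continuousP (T U : topologicalType) (A : set T) (f : T -> U) :
  {within A, continuous f} <->
  forall x, A x -> f @ within A (nbhs x) --> f x.
Proof.
split=> [cf x Ax | cf x].
  have := cf x; rewrite /continuous_at /=.
  by have [_|//] := nbhs_subspaceP A x.
rewrite /continuous_at; have [Ax|nAx] := nbhs_subspaceP A x; first exact: cf.
by move=> B /nbhs_singleton Bx y ->.
Qed.

(** * Limits of complex numbers and matrices along a filter *)

Section ComplexLimits.
Variable R : realType.
Local Notation C := (complex.complex R).
Local Notation re := (@complex.Re R).
Local Notation im := (@complex.Im R).

(** Real and imaginary parts are kept apart because [is_path] and [homotopic] express continuity
    through them. The filter is arbitrary so that [within A (nbhs x)] is covered. *)
Definition ccvg (T : Type) (F : set_system T) (f : T -> C) (l : C) : Prop :=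
  ((fun x => re (f x)) @ F --> re l) /\ ((fun x => im (f x)) @ F --> im l).

Section Arithmetic.
Variables (T : Type) (F : set_system T).
Context {FF : Filter F}.
Implicit Types (f g : T -> C) (a b : C).

Lemma ccvg_cst a : ccvg F (fun=> a) a.
Proof. by split; exact: cvg_cst. Qed.

Lemma ccvgD f g a b :
  ccvg F f a -> ccvg F g b -> ccvg F (fun x => f x + g x) (a + b).
Proof.
move=> [fa fa'] [gb gb']; split.
  have -> : (fun x => re (f x + g x)) = (fun x => re (f x)) \+ (fun x => re (g x)).
    by apply/funext => x /=; case: (f x) => ? ?; case: (g x).
  have -> : re (a + b) = re a + re b by case: (a); case: (b).
  exact: cvgD.
have -> : (fun x => im (f x + g x)) = (fun x => im (f x)) \+ (fun x => im (g x)).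
  by apply/funext => x /=; case: (f x) => ? ?; case: (g x).
have -> : im (a + b) = im a + im b by case: (a); case: (b).
exact: cvgD.
Qed.

Lemma ccvgM f g a b :
  ccvg F f a -> ccvg F g b -> ccvg F (fun x => f x * g x) (a * b).
Proof.
move=> [fa fa'] [gb gb']; split.
  have -> : (fun x => re (f x * g x)) =
     (fun x => re (f x) * re (g x) - im (f x) * im (g x)).
    by apply/funext => x /=; case: (f x) => ? ?; case: (g x).
  have -> : re (a * b) = re a * re b - im a * im b by case: (a); case: (b).
  by apply: cvgB; apply: cvgM.
have -> : (fun x => im (f x * g x)) =
    (fun x => re (f x) * im (g x) + im (f x) * re (g x)).
  by apply/funext => x /=; case: (f x) => ? ?; case: (g x).
have -> : im (a * b) = re a * im b + im a * re b by case: (a); case: (b).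
by apply: cvgD; apply: cvgM.
Qed.

Lemma ccvg_conj f a : ccvg F f a ->
  ccvg F (fun x => complex.conjc (f x)) (complex.conjc a).
Proof.
move=> [fa fa']; split.
  have -> : (fun x => re (complex.conjc (f x))) = (fun x => re (f x)).
    by apply/funext => x /=; case: (f x).
  by case: a fa {fa'}.
have -> : (fun x => im (complex.conjc (f x))) = (fun x => - im (f x)).
  by apply/funext => x /=; case: (f x).
have -> : im (complex.conjc a) = - im a by case: (a).
exact: cvgN.
Qed.

Lemma ccvgV f a : a != 0 -> ccvg F f a -> ccvg F (fun x => (f x)^-1) a^-1.
Proof.
move=> a0 [fa fa'].
pose n2 (z : C) := re z ^+ 2 + im z ^+ 2.
have n2a : n2 a != 0.
  apply: contra a0; rewrite /n2 paddr_eq0 ?sqr_ge0 // !sqrf_eq0.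
  by case: (a) => x y /=; rewrite eq_complex.
have cn2 : (fun x => n2 (f x)) @ F --> n2 a.
  rewrite /n2; apply: cvgD.
    under eq_fun do rewrite expr2; rewrite expr2; exact: cvgM.
  under eq_fun do rewrite expr2; rewrite expr2; exact: cvgM.
have cV := cvgV n2a cn2.
have rei z : re (z^-1) = re z * (n2 z)^-1 by case: z => u v.
have imi z : im (z^-1) = - (im z * (n2 z)^-1) by case: z => u v; rewrite /n2 /= ?mulNr.
split.
  under eq_fun do rewrite rei; rewrite rei; exact: (cvgM fa (cV _)).
under eq_fun do rewrite imi; rewrite imi; apply: cvgN; exact: (cvgM fa' (cV _)).
Qed.

Lemma ccvg_sum (I : Type) (r : seq I) (P : pred I) (f : I -> T -> C) (a : I -> C) :
  (forall i, P i -> ccvg F (f i) (a i)) ->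
  ccvg F (fun x => \sum_(i <- r | P i) f i x) (\sum_(i <- r | P i) a i).
Proof.
move=> fa; elim: r => [|i r IH].
  by under eq_fun do rewrite big_nil; rewrite big_nil; exact: ccvg_cst.
under eq_fun do rewrite big_cons; rewrite big_cons; case: ifP => // Pi.
by apply: ccvgD => //; exact: fa.
Qed.

Lemma ccvg_prod (I : Type) (r : seq I) (P : pred I) (f : I -> T -> C) (a : I -> C) :
  (forall i, P i -> ccvg F (f i) (a i)) ->
  ccvg F (fun x => \prod_(i <- r | P i) f i x) (\prod_(i <- r | P i) a i).
Proof.
move=> fa; elim: r => [|i r IH].
  by under eq_fun do rewrite big_nil; rewrite big_nil; exact: ccvg_cst.
under eq_fun do rewrite big_cons; rewrite big_cons; case: ifP => // Pi.
by apply: ccvgM => //; exact: fa.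
Qed.

Definition mcvg (m n : nat) (f : T -> 'M[C]_(m, n)) (A : 'M[C]_(m, n)) : Prop :=
  forall i j, ccvg F (fun x => f x i j) (A i j).

Lemma mcvg_cst (m n : nat) (A : 'M[C]_(m, n)) : mcvg (fun=> A) A.
Proof. by move=> i j; exact: ccvg_cst. Qed.

Lemma mcvgD (m n : nat) (f g : T -> 'M[C]_(m, n)) A B :
  mcvg f A -> mcvg g B -> mcvg (fun x => f x + g x) (A + B).
Proof.
move=> fA gB i j; under eq_fun do rewrite mxE; rewrite mxE; exact: ccvgD.
Qed.

Lemma mcvgZ (m n : nat) (f : T -> C) (g : T -> 'M[C]_(m, n)) a B :
  ccvg F f a -> mcvg g B -> mcvg (fun x => f x *: g x) (a *: B).
Proof.
move=> fA gB i j; under eq_fun do rewrite mxE; rewrite mxE; exact: ccvgM.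
Qed.

Lemma mcvgM (m n p : nat) (f : T -> 'M[C]_(m, n)) (g : T -> 'M[C]_(n, p)) A B :
  mcvg f A -> mcvg g B -> mcvg (fun x => f x *m g x) (A *m B).
Proof.
move=> fA gB i j; under eq_fun do rewrite mxE; rewrite mxE.
by apply: ccvg_sum => k _; exact: ccvgM.
Qed.

Lemma mcvg_adjmx (m n : nat) (f : T -> 'M[C]_(m, n)) A :
  mcvg f A -> mcvg (fun x => adjmx (f x)) (adjmx A).
Proof.
move=> fA i j; under eq_fun do rewrite /adjmx !mxE; rewrite /adjmx !mxE.
exact: ccvg_conj.
Qed.

Lemma ccvg_det (n : nat) (f : T -> 'M[C]_n) A :
  mcvg f A -> ccvg F (fun x => \det (f x)) (\det A).
Proof.
move=> fA; apply: ccvg_sum => s _; apply: ccvgM; first exact: ccvg_cst.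
by apply: ccvg_prod.
Qed.

Lemma mcvg_adj (n : nat) (f : T -> 'M[C]_n) A :
  mcvg f A -> mcvg (fun x => \adj (f x)) (\adj A).
Proof.
move=> fA i j; under eq_fun do rewrite mxE /cofactor; rewrite mxE /cofactor.
apply: ccvgM; first exact: ccvg_cst.
apply: ccvg_det => u v; under eq_fun do rewrite !mxE; rewrite !mxE; exact: fA.
Qed.

End Arithmetic.
End ComplexLimits.

(** * Continuity on a subset for real, complex and matrix functions *)

Section Contin.
Variable R : realType.
Local Notation C := (complex.complex R).

Definition rcontin (T : topologicalType) (A : set T) (f : T -> R) : Prop :=
  forall x, A x -> f @ within A (nbhs x) --> f x.

Definition ccontin (T : topologicalType) (A : set T) (f : T -> C) : Prop :=
  forall x, A x -> ccvg (within A (nbhs x)) f (f x).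

Definition mcontin (m n : nat) (T : topologicalType) (A : set T)
    (f : T -> 'M[C]_(m, n)) : Prop :=
  forall x, A x -> mcvg (within A (nbhs x)) f (f x).

Lemma cvg_within_self (T U : topologicalType) (A : set T) (B : set U)
    (g : T -> U) (x : T) :
  (forall y, A y -> B (g y)) -> g @ within A (nbhs x) --> g x ->
  g @ within A (nbhs x) --> within B (nbhs (g x)).
Proof.
move=> AB gx V nV.
have gV : \forall y \near x, A y -> B (g y) -> V (g y) := gx _ nV.
suff : \forall y \near x, A y -> V (g y) by [].
by apply: filterS gV => y h Ay; apply: h => //; exact: AB.
Qed.

Section Closure.
Variables (T : topologicalType) (A : set T).

Lemma rcontin_cst a : rcontin A (fun=> a).
Proof. by move=> x Ax; exact: cvg_cst. Qed.

Lemma continuous_rcontin f : continuous f -> rcontin A f.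
Proof. by move=> cf x Ax; apply: cvg_within_filter; exact: cf. Qed.

Lemma rcontinD f g : rcontin A f -> rcontin A g -> rcontin A (fun x => f x + g x).
Proof. by move=> cf cg x Ax; apply: cvgD; [exact: cf|exact: cg]. Qed.

Lemma rcontinN f : rcontin A f -> rcontin A (fun x => - f x).
Proof. by move=> cf x Ax; apply: cvgN; exact: cf. Qed.

Lemma rcontinB f g : rcontin A f -> rcontin A g -> rcontin A (fun x => f x - g x).
Proof. by move=> cf cg; apply: rcontinD => //; exact: rcontinN. Qed.

Lemma rcontinM f g : rcontin A f -> rcontin A g -> rcontin A (fun x => f x * g x).
Proof. by move=> cf cg x Ax; apply: cvgM; [exact: cf|exact: cg]. Qed.

Lemma rcontin_comp (h : R -> R) f :
  continuous h -> rcontin A f -> rcontin A (fun x => h (f x)).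
Proof. by move=> ch cf x Ax; exact: (cvg_comp f h (cf x Ax) (ch _)). Qed.

Lemma ccontin_cst a : ccontin A (fun=> a).
Proof. by move=> x Ax; exact: ccvg_cst. Qed.

Lemma ccontin_pair f g : rcontin A f -> rcontin A g ->
  ccontin A (fun x => complex.Complex (f x) (g x)).
Proof. by move=> cf cg x Ax; split; [exact: cf|exact: cg]. Qed.

Lemma rcontin_Re f : ccontin A f -> rcontin A (fun x => complex.Re (f x)).
Proof. by move=> cf x /cf[]. Qed.

Lemma rcontin_Im f : ccontin A f -> rcontin A (fun x => complex.Im (f x)).
Proof. by move=> cf x /cf[]. Qed.

Lemma ccontinD f g : ccontin A f -> ccontin A g -> ccontin A (fun x => f x + g x).
Proof. by move=> cf cg x Ax; apply: ccvgD; [exact: cf|exact: cg]. Qed.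

Lemma ccontinM f g : ccontin A f -> ccontin A g -> ccontin A (fun x => f x * g x).
Proof. by move=> cf cg x Ax; apply: ccvgM; [exact: cf|exact: cg]. Qed.

Lemma ccontin_conj f : ccontin A f -> ccontin A (fun x => complex.conjc (f x)).
Proof. by move=> cf x Ax; apply: ccvg_conj; exact: cf. Qed.

Lemma ccontinV f : (forall x, A x -> f x != 0) ->
  ccontin A f -> ccontin A (fun x => (f x)^-1).
Proof. by move=> f0 cf x Ax; apply: ccvgV; [exact: f0|exact: cf]. Qed.

Variables (m n : nat).
Implicit Types F G : T -> 'M[C]_(m, n).

Lemma mcontin_cst (B : 'M[C]_(m, n)) : mcontin A (fun=> B).
Proof. by move=> x Ax; exact: mcvg_cst. Qed.

Lemma mcontinD F G : mcontin A F -> mcontin A G -> mcontin A (fun x => F x + G x).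
Proof. by move=> cf cg x Ax; apply: mcvgD; [exact: cf|exact: cg]. Qed.

Lemma mcontinZ f G : ccontin A f -> mcontin A G -> mcontin A (fun x => f x *: G x).
Proof. by move=> cf cg x Ax; apply: mcvgZ; [exact: cf|exact: cg]. Qed.

Lemma mcontinM p F (G : T -> 'M[C]_(n, p)) :
  mcontin A F -> mcontin A G -> mcontin A (fun x => F x *m G x).
Proof. by move=> cf cg x Ax; apply: mcvgM; [exact: cf|exact: cg]. Qed.

Lemma mcontin_adjmx F : mcontin A F -> mcontin A (fun x => adjmx (F x)).
Proof. by move=> cf x Ax; apply: mcvg_adjmx; exact: cf. Qed.

Lemma mcontin_scalar f : ccontin A f -> mcontin A (fun x => (f x)%:M : 'M[C]_n).
Proof.
move=> cf x Ax i j; under eq_fun do rewrite mxE; rewrite mxE.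
by case: (i == j) => /=; [exact: cf|exact: ccvg_cst].
Qed.

Lemma mcontin_diag (f : 'I_n -> T -> C) : (forall j, ccontin A (f j)) ->
  mcontin A (fun x => diag_mx (\row_j f j x)).
Proof.
move=> cf x Ax i j; under eq_fun do rewrite !mxE; rewrite !mxE.
by case: eqP => [->|_] /=; [exact: cf|exact: ccvg_cst].
Qed.

Lemma ccontin_det (F : T -> 'M[C]_n) : mcontin A F -> ccontin A (fun x => \det (F x)).
Proof. by move=> cf x Ax; apply: ccvg_det; exact: cf. Qed.

Lemma mcontin_adj (F : T -> 'M[C]_n) : mcontin A F -> mcontin A (fun x => \adj (F x)).
Proof. by move=> cf x Ax; apply: mcvg_adj; exact: cf. Qed.

End Closure.

Section Composition.
Variables (T U : topologicalType) (A : set T) (B : set U) (g : T -> U).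
Hypothesis AB : forall y, A y -> B (g y).
Hypothesis cg : forall x, A x -> g @ within A (nbhs x) --> g x.

Lemma rcontin_precomp (f : U -> R) : rcontin B f -> rcontin A (fun x => f (g x)).
Proof.
move=> cf x Ax; apply: (cvg_comp g f _ (cf _ (AB Ax))).
by apply: cvg_within_self => //; exact: cg.
Qed.

Lemma ccontin_precomp (f : U -> C) : ccontin B f -> ccontin A (fun x => f (g x)).
Proof.
move=> cf x Ax; split.
  move: x Ax; apply: (@rcontin_precomp (fun y => complex.Re (f y))).
  exact: rcontin_Re.
move: x Ax; apply: (@rcontin_precomp (fun y => complex.Im (f y))).
exact: rcontin_Im.
Qed.

Lemma mcontin_precomp m n (f : U -> 'M[C]_(m, n)) :
  mcontin B f -> mcontin A (fun x => f (g x)).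
Proof.
move=> cf x Ax i j; move: x Ax.
by apply: (@ccontin_precomp (fun y => f y i j)) => y By; exact: cf.
Qed.

End Composition.

Lemma eq_rcontin (T : topologicalType) (A : set T) (f g : T -> R) :
  (forall x, A x -> f x = g x) -> rcontin A f -> rcontin A g.
Proof.
move=> fg cf x Ax; rewrite -fg //; apply: cvg_trans (cf x Ax).
apply: near_eq_cvg; rewrite /prop_near1 /within /=.
by apply: nearW => y Ay; rewrite fg.
Qed.

Lemma eq_mcontin m n (T : topologicalType) (A : set T) (f g : T -> 'M[C]_(m, n)) :
  (forall x, A x -> f x = g x) -> mcontin A f -> mcontin A g.
Proof.
move=> fg cf x Ax i j; split.
  move: x Ax; apply: (@eq_rcontin _ _ (fun y => complex.Re (f y i j))).
    by move=> y Ay; rewrite fg.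
  by move=> y Ay; case: (cf y Ay i j).
move: x Ax; apply: (@eq_rcontin _ _ (fun y => complex.Im (f y i j))).
  by move=> y Ay; rewrite fg.
by move=> y Ay; case: (cf y Ay i j).
Qed.

Lemma mcontin_withinP m n (T : topologicalType) (A : set T) (f : T -> 'M[C]_(m, n)) :
  mcontin A f <-> forall i j,
    {within A, continuous (fun x => complex.Re (f x i j))} /\
    {within A, continuous (fun x => complex.Im (f x i j))}.
Proof.
split=> [cf i j | cf x Ax i j].
  by split; apply/within_continuousP => x Ax; case: (cf x Ax i j).
by have [/within_continuousP h1 /within_continuousP h2] := cf i j; split; [exact: h1|exact: h2].
Qed.

End Contin.

(** * Adjoints and unitary matrices *)

Section Unitary.
Variables (R : realType).
Local Notation C := (complex.complex R).

Lemma adjmxM m n p (A : 'M[C]_(m, n)) (B : 'M[C]_(n, p)) :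
  adjmx (A *m B) = adjmx B *m adjmx A.
Proof. by rewrite /adjmx map_mxM trmx_mul. Qed.

Lemma adjmxK m n (A : 'M[C]_(m, n)) : adjmx (adjmx A) = A.
Proof. by apply/matrixP => i j; rewrite !mxE conjcK. Qed.

Lemma adjmx1 n : adjmx (1%:M : 'M[C]_n) = 1%:M.
Proof. by rewrite /adjmx map_mx1 trmx1. Qed.

Lemma adjmxD m n (A B : 'M[C]_(m, n)) : adjmx (A + B) = adjmx A + adjmx B.
Proof. by rewrite /adjmx map_mxD linearD. Qed.

Lemma adjmxZ m n a (A : 'M[C]_(m, n)) : adjmx (a *: A) = complex.conjc a *: adjmx A.
Proof. by rewrite /adjmx map_mxZ linearZ. Qed.

Variable n : nat.
Implicit Types A B : 'M[C]_n.

Lemma unitary1 : @unitary R n 1%:M.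
Proof. by rewrite /unitary adjmx1 mulmx1. Qed.

Lemma unitaryM A B : unitary A -> unitary B -> unitary (A *m B).
Proof.
rewrite /unitary => UA UB; rewrite adjmxM mulmxA -(mulmxA A) UB mulmx1 //.
Qed.

Lemma unitary_mulVmx A : unitary A -> adjmx A *m A = 1%:M.
Proof. exact: mulmx1C. Qed.

Lemma unitary_adjmx A : unitary A -> unitary (adjmx A).
Proof. by move=> UA; rewrite /unitary adjmxK unitary_mulVmx. Qed.

Lemma det_adjmx A : \det (adjmx A) = complex.conjc (\det A).
Proof. by rewrite /adjmx det_tr det_map_mx. Qed.

Lemma unitary_det A : unitary A -> \det A * complex.conjc (\det A) = 1.
Proof. by move=> UA; rewrite -det_adjmx -det_mulmx UA det1. Qed.

End Unitary.

(** * Homotopy classes of paths and their pointwise group structure *)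

Section Homotopy.
Variables (R : realType) (n : nat).
Local Notation C := (complex.complex R).
Local Notation M := ('M[C]_n).
Local Notation I := (@I01 R).
Implicit Types (u v w : mpath R n).

Lemma I01E t : I t = (0 <= t <= 1) :> Prop.
Proof. by rewrite /I01 /= in_itv. Qed.

Lemma I010 : I 0. Proof. by rewrite I01E lexx ler01. Qed.
Lemma I011 : I 1. Proof. by rewrite I01E lexx ler01. Qed.
Hint Resolve I010 I011 : core.

Lemma I01M s t : I s -> I t -> I (s * t).
Proof.
rewrite !I01E => /andP[s0 s1] /andP[t0 t1].
by rewrite mulr_ge0 //= mulr_ile1.
Qed.

Lemma is_pathP u : is_path u <->
  [/\ u 0 = 1%:M, (forall t, I t -> unitary (u t)) & mcontin I u].
Proof.
split; case=> u0 uu cu; split => //; first exact/mcontin_withinP.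
by move=> i j; have /mcontin_withinP := cu; exact.
Qed.

(** The left end is pinned to [1%:M] rather than to [u 0]; the conditions that [u] and [v] are paths
    can then be recovered from [H] alone. *)
Definition is_homotopy (H : R -> R -> M) u v : Prop :=
  [/\ mcontin (I `*` I) (fun p => H p.1 p.2),
      forall s t, I s -> I t -> unitary (H s t),
      forall t, I t -> H 0 t = u t /\ H 1 t = v t
    & forall s, I s -> H s 0 = 1%:M /\ H s 1 = u 1].

Lemma rcontin_fst (A : set (R * R)) : rcontin A fst.
Proof. by move=> [x y] _; apply: cvg_within_filter; exact: cvg_fst. Qed.

Lemma rcontin_snd (A : set (R * R)) : rcontin A snd.
Proof. by move=> [x y] _; apply: cvg_within_filter; exact: cvg_snd. Qed.

Lemma mcontin_snd (u : R -> M) : mcontin I u ->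
  mcontin (I `*` I) (fun p => u p.2).
Proof.
move=> cu; apply: (@mcontin_precomp _ _ _ (I `*` I) I (fun p => p.2)) => //.
  by case=> s t [].
exact: rcontin_snd.
Qed.

Lemma rcontin_pair (T : topologicalType) (A : set T) (f g : T -> R) :
  rcontin A f -> rcontin A g ->
  forall x, A x -> (fun y => (f y, g y)) @ within A (nbhs x) --> (f x, g x).
Proof. by move=> cf cg x Ax; apply: (@cvg_pair _ _ _ (within A (nbhs x)) (nbhs (f x)) (nbhs (g x))); [exact: cf|exact: cg]. Qed.

Lemma mcontin_slice (H : R -> R -> M) s : I s ->
  mcontin (I `*` I) (fun p => H p.1 p.2) -> mcontin I (H s).
Proof.
move=> Is cH.
apply: (@mcontin_precomp _ _ _ I (I `*` I) (fun t => (s, t)) _ _ _ _ _ cH) => //.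
apply: rcontin_pair; first exact: rcontin_cst.
by apply: continuous_rcontin => x; exact: cvg_id.
Qed.

Lemma homotopicP u v : homotopic u v <-> exists H, is_homotopy H u v.
Proof.
split=> [[/is_pathP[u0 uu cu] [pv [H [cH uH He Hs]]]] | [H [cH uH He Hs]]].
  exists H; split => //; first exact/mcontin_withinP.
  by move=> s /Hs[-> ->].
have u0 : u 0 = 1%:M by have [<- _] := He 0 I010; have [] := Hs 0 I010.
have v0 : v 0 = 1%:M by have [_ <-] := He 0 I010; have [] := Hs 1 I011.
split; last split.
- apply/is_pathP; split => //; first by move=> t It; have [<- _] := He t It; exact: uH.
  by apply: (@eq_mcontin _ _ _ _ _ (H 0)); [move=> t /He[]|exact: mcontin_slice].
- apply/is_pathP; split => //; first by move=> t It; have [_ <-] := He t It; exact: uH.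
  by apply: (@eq_mcontin _ _ _ _ _ (H 1)); [move=> t /He[]|exact: mcontin_slice].
exists H; split => //; first by move=> i j; have /mcontin_withinP := cH; exact.
by move=> s /Hs[-> ->]; rewrite u0.
Qed.

Lemma homotopic_path_l u v : homotopic u v -> is_path u. Proof. by case. Qed.
Lemma homotopic_path_r u v : homotopic u v -> is_path v. Proof. by case=> _ []. Qed.

Lemma homotopic_end u v : homotopic u v -> v 1 = u 1.
Proof.
move=> /homotopicP[H [_ _ He Hs]].
by have [_ <-] := He 1 I011; have [_ <-] := Hs 1 I011.
Qed.

Lemma eq_homotopic u v : is_path u -> (forall t, I t -> u t = v t) -> homotopic u v.
Proof.
move=> /is_pathP[u0 uu cu] uv; apply/homotopicP; exists (fun _ t => u t); split => //.
- exact: mcontin_snd.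
- by move=> s t _; exact: uu.
- by move=> t It; rewrite -uv.
Qed.

Lemma homotopic_refl u : is_path u -> homotopic u u.
Proof. by move=> pu; exact: eq_homotopic. Qed.

Lemma homotopic_sym u v : homotopic u v -> homotopic v u.
Proof.
move=> huv; have e := homotopic_end huv.
move: huv => /homotopicP[H [cH uH He Hs]]; apply/homotopicP.
have Irev s : I s -> I (1 - s) by rewrite !I01E => /andP[? ?]; lra.
exists (fun s t => H (1 - s) t); split.
- apply: (@mcontin_precomp _ _ _ (I `*` I) (I `*` I) (fun p => (1 - p.1, p.2)) _ _ _ _ _ cH) => //.
    by move=> [s t] [Is It]; split => //=; exact: Irev.
  apply: rcontin_pair; last exact: rcontin_snd.
  by apply: rcontinB; [exact: rcontin_cst|exact: rcontin_fst].
- by move=> s t Is It; apply: uH => //; exact: Irev.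
- by move=> t It; rewrite subr0 subrr; have [-> ->] := He t It.
- by move=> s /Irev /Hs; rewrite e.
Qed.

Lemma is_pathM u v : is_path u -> is_path v -> is_path (pmul u v).
Proof.
move=> /is_pathP[u0 uu cu] /is_pathP[v0 uv cv]; apply/is_pathP; split.
- by rewrite /pmul u0 v0 mulmx1.
- by move=> t It; apply: unitaryM; [exact: uu|exact: uv].
- exact: mcontinM.
Qed.

Lemma is_pathV u : is_path u -> is_path (Defs.pinv u).
Proof.
move=> /is_pathP[u0 uu cu]; apply/is_pathP; split.
- by rewrite /Defs.pinv u0 adjmx1.
- by move=> t It; apply: unitary_adjmx; exact: uu.
- exact: mcontin_adjmx.
Qed.

Lemma homotopicM u v u' v' :
  homotopic u u' -> homotopic v v' -> homotopic (pmul u v) (pmul u' v').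
Proof.
move=> /homotopicP[H [cH uH He Hs]] /homotopicP[K [cK uK Ke Ks]].
apply/homotopicP; exists (fun s t => H s t *m K s t); split.
- exact: mcontinM.
- by move=> s t Is It; apply: unitaryM; [exact: uH|exact: uK].
- by move=> t It; rewrite /pmul; have [-> ->] := He t It; have [-> ->] := Ke t It.
- move=> s Is; rewrite /pmul; have [-> ->] := Hs s Is; have [-> ->] := Ks s Is.
  by rewrite mulmx1.
Qed.

Lemma homotopicV u v : homotopic u v -> homotopic (Defs.pinv u) (Defs.pinv v).
Proof.
move=> /homotopicP[H [cH uH He Hs]].
apply/homotopicP; exists (fun s t => adjmx (H s t)); split.
- exact: mcontin_adjmx.
- by move=> s t Is It; apply: unitary_adjmx; exact: uH.
- by move=> t It; rewrite /Defs.pinv; have [-> ->] := He t It.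
- by move=> s Is; rewrite /Defs.pinv; have [-> ->] := Hs s Is; rewrite adjmx1.
Qed.

(* The pointwise group structure replaces the pasting of homotopies:
   H v^* K is a homotopy from u v^* v = u to v v^* w = w. *)
Lemma homotopic_trans v u w : homotopic u v -> homotopic v w -> homotopic u w.
Proof.
move=> huv; have pv := homotopic_path_r huv.
have e := homotopic_end huv; move: huv pv.
move=> /homotopicP[H [cH uH He Hs]] /is_pathP[v0 uv cv] /homotopicP[K [cK uK Ke Ks]].
apply/homotopicP; exists (fun s t => H s t *m adjmx (v t) *m K s t); split.
- apply: mcontinM => //; apply: mcontinM => //; apply: mcontin_adjmx.
  exact: mcontin_snd.
- move=> s t Is It; apply: unitaryM; last exact: uK.
  by apply: unitaryM; [exact: uH|apply: unitary_adjmx; exact: uv].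
- move=> t It; have [-> ->] := He t It; have [-> ->] := Ke t It.
  rewrite -mulmxA unitary_mulVmx ?mulmx1; last exact: uv.
  by rewrite (uv t It) mul1mx.
- move=> s Is; have [-> ->] := Hs s Is; have [-> ->] := Ks s Is.
  rewrite v0 adjmx1 !mulmx1 -mulmxA unitary_mulVmx ?mulmx1 //; exact: uv.
Qed.

End Homotopy.

#[export] Hint Resolve I010 I011 : core.

(** Connectedness of the unit interval as an induction principle. Since [P] spreads in both
    directions near every point, the supremum of the points satisfying [P] satisfies it too and
    cannot lie below 1. It replaces subdivisions of the interval, both in the classification of
    paths and in the lifting arguments. *)
Lemma subitv_ind (R : realType) (P : R -> Prop) :
  P 0 ->
  (forall x, I01 x -> exists2 e, 0 < e & forall y z, I01 y -> I01 z ->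
     `|y - x| < e -> `|z - x| < e -> P y -> P z) ->
  P 1.
Proof.
move=> P0 loc.
pose S := [set x : R | I01 x /\ P x].
have S0 : S 0 by split.
have hS : has_sup S.
  by split; [exists 0|exists 1 => x [+ _]; rewrite I01E => /andP[]].
set m := sup S.
have Im : I01 m.
  rewrite I01E; apply/andP; split; first exact: (ub_le_sup hS.2 S0).
  by apply: ge_sup; [exists 0|move=> x [+ _]; rewrite I01E => /andP[]].
have [e e0 he] := loc m Im.
have [y [Iy Py] ye] := sup_adherent e0 hS.
have ym : y <= m by exact: (ub_le_sup hS.2 (conj Iy Py)).
have yme : `|y - m| < e by rewrite distrC ger0_norm ?subr_ge0 // ltrBlDr -ltrBlDl.
have Pm : P m by apply: he Py => //; rewrite subrr normr0.
move: Im; rewrite I01E => /andP[m0 m1].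
have [m1'|m1'] := eqVneq m 1; first by rewrite -m1'.
have {}m1 : m < 1 by rewrite lt_neqAle m1' m1.
pose z := Num.min 1 (m + e / 2).
have mz : m < z by rewrite /z lt_min m1 /= ltrDl divr_gt0.
have Iz : I01 z by rewrite I01E (le_trans m0 (ltW mz)) /= /z ge_min lexx.
suff Sz : S z.
  by have := ub_le_sup hS.2 Sz; rewrite leNgt mz.
split => //; apply: he Pm => //; rewrite ?I01E ?m0 ?ltW // ?subrr ?normr0 //.
rewrite gtr0_norm ?subr_gt0 // ltrBlDl.
have : z <= m + e / 2 by rewrite /z ge_min lexx orbT.
by move=> h; lra.
Qed.

(** * The unit circle and its angles *)

Section Cis.
Variable R : realType.
Local Notation C := (complex.complex R).
Implicit Types (a b t : R) (z : C).

(** This is $e^{ia}$, in the literal form used by [det_lift]. *)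
Definition cis a : C := complex.Complex (cos a) (sin a).

Lemma cis0 : cis 0 = 1.
Proof. by rewrite /cis cos0 sin0. Qed.

Lemma cisD a b : cis (a + b) = cis a * cis b.
Proof.
rewrite /cis cosD sinD; congr complex.Complex => /=; ring.
Qed.

Lemma cisN a : cis (- a) = complex.conjc (cis a).
Proof. by rewrite /cis cosN sinN. Qed.

Lemma cisMconj a : cis a * complex.conjc (cis a) = 1.
Proof. by rewrite -cisN -cisD subrr cis0. Qed.

Lemma cis_neq0 a : cis a != 0.
Proof.
apply/eqP => a0; have := cisMconj a; rewrite a0 mul0r => /eqP.
by rewrite eq_sym oner_eq0.
Qed.

Lemma cis_sum (I : Type) (r : seq I) (f : I -> R) :
  cis (\sum_(i <- r) f i) = \prod_(i <- r) cis (f i).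
Proof.
elim: r => [|i r IH]; first by rewrite !big_nil cis0.
by rewrite !big_cons cisD IH.
Qed.

Lemma cisX a k : cis (a *+ k) = cis a ^+ k.
Proof. by elim: k => [|k IH]; rewrite ?mulr0n ?cis0 // mulrS cisD IH exprS. Qed.

Lemma cis_int (m : int) : cis (pi *+ 2 * m%:~R) = 1.
Proof.
have nat_case k : cis (pi *+ 2 * k%:R) = 1.
  by rewrite mulr_natr cisX /cis cos2pi sin2pi expr1n.
case: m => k; first by rewrite -pmulrn nat_case.
by rewrite NegzE mulrNz mulrN cisN -pmulrn nat_case conjc1.
Qed.

(** After reduction of [a] to $y \in [0, 2\pi)$, the half-angle formula gives $\sin(y/2) = 0$ with
    $y/2 \in [0, \pi)$, hence $y = 0$. *)
Lemma cos_eq1_int a : cos a = 1 -> exists m : int, a = pi *+ 2 * m%:~R.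
Proof.
move=> ca; have p0 : (0 : R) < pi *+ 2 by rewrite mulrn_wgt0 ?pi_gt0.
pose m := Num.floor (a / (pi *+ 2)); exists m.
pose y := a - pi *+ 2 * m%:~R.
have cy : cis y = cis a.
  by rewrite /y cisD -mulrN -mulrNz cis_int mulr1.
have y0 : 0 <= y.
  by rewrite /y subr_ge0 mulrC -ler_pdivlMr // floor_le_tmp.
have y2 : y < pi *+ 2.
  have : a / (pi *+ 2) < m%:~R + 1 by rewrite -intrD1 floorD1_gt.
  by rewrite ltr_pdivrMr // => h; rewrite /y; lra.
apply/eqP; rewrite -subr_eq0 -/y; apply: contraT => yn0.
have {yn0}y0 : 0 < y by rewrite lt_neqAle eq_sym yn0.
have s0 : 0 < sin (y / 2).
  by rewrite -mulr_natr in y2; apply: sin_gt0_pi; apply/andP; split; lra.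
have := congr1 (@complex.Re R) cy; rewrite /= ca.
have -> : y = (y / 2) *+ 2 by rewrite -mulr_natr divfK.
rewrite cos_mulr2n cos2sin2 => h.
have : sin (y / 2) ^+ 2 = 0 by lra.
by move=> /eqP; rewrite sqrf_eq0 (gt_eqF s0).
Qed.

Lemma cis_eq_int a b : cis a = cis b -> exists m : int, a - b = pi *+ 2 * m%:~R.
Proof.
move=> ab; apply: cos_eq1_int.
have : cis (a - b) = 1 by rewrite cisD ab cisN cisMconj.
by move=> /(congr1 (@complex.Re R)).
Qed.

Lemma unit_cis z : z * complex.conjc z = 1 -> exists a, z = cis a.
Proof.
case: z => x y /(congr1 (@complex.Re R)) /= xy.
have {}xy : x ^+ 2 + y ^+ 2 = 1 by rewrite -xy !expr2; ring.
have x1 : -1 <= x <= 1.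
  have : x ^+ 2 <= 1 by rewrite -xy lerDl sqr_ge0.
  by rewrite expr2 => h; apply/andP; split; nra.
have sx : sin (acos x) = `|y|.
  by rewrite sin_acos // -xy addrAC subrr add0r sqrtr_sqr.
have cx : cos (acos x) = x by rewrite acosK // in_itv.
have [y0|y0] := leP 0 y.
  by exists (acos x); rewrite /cis cx sx ger0_norm.
by exists (- acos x); rewrite /cis cosN sinN cx sx ltr0_norm // opprK.
Qed.

Lemma ccontin_cis (T : topologicalType) (A : set T) (f : T -> R) :
  rcontin A f -> ccontin A (fun x => cis (f x)).
Proof.
move=> cf; apply: ccontin_pair; apply: rcontin_comp => //.
  exact: continuous_cos.
exact: continuous_sin.
Qed.

Lemma cos_atan_neq0 t : cos (atan t) != 0.
Proof.
by rewrite gt_eqF // cos_gt0_pihalf // atan_gtNpi2 atan_ltpi2.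
Qed.

Lemma cis_atan t : cis (atan t) = complex.Complex (cos (atan t)) 0 * complex.Complex 1 t.
Proof.
have : sin (atan t) = cos (atan t) * t.
  by rewrite -{3}(atanK t) /tan mulrCA mulfV ?cos_atan_neq0 // mulr1.
by rewrite /cis => ->; congr complex.Complex => /=; ring.
Qed.

(* With [z = cis a], both sides are divided by [cis (a / 2)]; the Cayley
   transform then turns the segment [t tan(a / 2)] into an arc. *)
Lemma cayley_cis a t : cis a != -1 ->
  let d := complex.Complex (1 - t) 0 * cis a + complex.Complex (1 + t) 0 in
  d != 0 /\
  complex.Complex (1 + t) 0 * cis a + complex.Complex (1 - t) 0 =
    d * cis (atan (t * tan (a / 2)) *+ 2).
Proof.
move=> a1 d; set h := a / 2; set y := atan _.
have ah : a = h + h by rewrite /h; field.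
have ch : cos h != 0.
  apply: contra a1 => /eqP c0; rewrite ah cisD /cis c0.
  have s2 : sin h ^+ 2 = 1 by rewrite sin2cos2 c0 expr0n subr0.
  apply/eqP; congr complex.Complex => /=; first by rewrite mul0r sub0r -expr2 s2.
  by rewrite mul0r mulr0 addr0 oppr0.
have cy : cos y != 0 by exact: cos_atan_neq0.
have ty : sin y * cos h = cos y * (t * sin h).
  have : tan y = t * tan h by rewrite atanK.
  rewrite /tan => e.
  have : sin y / cos y * (cos y * cos h) = t * (sin h / cos h) * (cos y * cos h) by rewrite e.
  have -> : sin y / cos y * (cos y * cos h) = sin y * cos h by field.
  by move=> ->; field.
have h1 := cos2Dsin2 h; have h2 := cos2Dsin2 y.
have dE : complex.Complex (cos y) 0 * d =
   complex.Complex (2 * cos h) 0 * (cis h * complex.conjc (cis y)).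
  rewrite /d ah cisD /cis /=; congr complex.Complex => /=.
    by rewrite ?expr2 in h1; move: (congr1 ( *%R (cos y * (1 + t))) h1) (congr1 ( *%R (sin h)) ty); lra.
  by move: (congr1 ( *%R (cos h)) ty); lra.
have nE : complex.Complex (cos y) 0 *
    (complex.Complex (1 + t) 0 * cis a + complex.Complex (1 - t) 0) =
   complex.Complex (2 * cos h) 0 * (cis h * cis y).
  rewrite ah cisD /cis /=; congr complex.Complex => /=.
    by rewrite ?expr2 in h1; move: (congr1 ( *%R (cos y * (1 - t))) h1) (congr1 ( *%R (sin h)) ty); lra.
  by move: (congr1 ( *%R (cos h)) ty); lra.
have cy' : complex.Complex (cos y) 0 != 0 :> C by rewrite eq_complex /= negb_and cy.
split.
  apply: contraNneq ch => d0; have := dE; rewrite d0 mulr0 => /esym/eqP.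
  rewrite !mulf_eq0 -cisN (negbTE (cis_neq0 _)) (negbTE (cis_neq0 _)) !orbF.
  by rewrite eq_complex /= eqxx andbT mulf_eq0 pnatr_eq0.
apply: (mulfI cy'); rewrite nE [RHS]mulrA dE mulr2n cisD.
rewrite -!mulrA; congr (_ * (_ * _)).
by rewrite mulrA [complex.conjc _ * _]mulrC cisMconj mul1r.
Qed.

End Cis.

(** * Paths that are diagonal in a fixed unitary frame, and diagonal loops *)

Section Diagonal.
Variables (R : realType) (n : nat).
Local Notation C := (complex.complex R).
Local Notation M := ('M[C]_n).
Local Notation I := (@I01 R).
Implicit Types (a b : 'I_n -> R) (V W A : M).

Definition cisdiag b : M := diag_mx (\row_j cis (b j)).

Lemma cisdiag0 b : (forall j, b j = 0) -> cisdiag b = 1%:M.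
Proof.
move=> b0; apply/matrixP => i j; rewrite !mxE b0 cis0.
by case: (i == j).
Qed.

Lemma eq_cisdiag a b : (forall j, cis (a j) = cis (b j)) -> cisdiag a = cisdiag b.
Proof. by move=> ab; congr diag_mx; apply/rowP => j; rewrite !mxE ab. Qed.

Lemma cisdiagD a b : cisdiag a *m cisdiag b = cisdiag (fun j => a j + b j).
Proof.
by rewrite mulmx_diag; congr diag_mx; apply/rowP => j; rewrite !mxE cisD.
Qed.

Lemma cisdiagN b : adjmx (cisdiag b) = cisdiag (fun j => - b j).
Proof.
rewrite /adjmx map_diag_mx tr_diag_mx; congr diag_mx.
by apply/rowP => j; rewrite !mxE cisN.
Qed.

Lemma unitary_cisdiag b : unitary (cisdiag b).
Proof. by rewrite /unitary cisdiagN cisdiagD cisdiag0 // => j; rewrite subrr. Qed.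

Lemma det_cisdiag b : \det (cisdiag b) = cis (\sum_j b j).
Proof. by rewrite det_diag cis_sum; apply: eq_bigr => j _; rewrite mxE. Qed.

Lemma mcontin_cisdiag (T : topologicalType) (S : set T) (f : 'I_n -> T -> R) :
  (forall j, rcontin S (f j)) -> mcontin S (fun x => cisdiag (f ^~ x)).
Proof. by move=> cf; apply: mcontin_diag => j; exact: ccontin_cis. Qed.

(** A unitary matrix is normal, hence unitarily diagonalizable; the diagonal factor is again
    unitary, so its entries have modulus one and are given by angles. Neither [V] nor [a] is claimed
    to depend continuously on [A]. *)
Lemma unitary_spectral A : unitary A ->
  exists V a, unitary V /\ A = V *m cisdiag a *m adjmx V.
Proof.
move=> UA.
have adjE m p (B : 'M[C]_(m, p)) : map_mx Num.conj (B^T) = adjmx B.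
  by apply/matrixP => i j; rewrite !mxE.
have /orthomx_spectralP Ae : A \is normalmx.
  by apply/normalmxP; rewrite adjE UA unitary_mulVmx.
set P := spectralmx A in Ae; set d := spectral_diag A in Ae.
have UP : unitary P.
  by have /unitarymxP := spectral_unitarymx A; rewrite adjE.
rewrite invmx_unitary ?spectral_unitarymx // adjE in Ae.
have Ud : diag_mx d *m adjmx (diag_mx d) = 1%:M.
  have -> : diag_mx d = P *m A *m adjmx P.
    by rewrite Ae !mulmxA UP mul1mx -mulmxA UP mulmx1.
  by apply: unitaryM; [exact: unitaryM|exact: unitary_adjmx].
have /choice[a ha] : forall j, exists x, d 0 j = cis x.
  move=> j; apply: unit_cis; have /matrixP/(_ j j) := Ud.
  rewrite /adjmx map_diag_mx tr_diag_mx mulmx_diag !mxE eqxx.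
  by rewrite !mulr1n.
exists (adjmx P), a; split; first exact: unitary_adjmx.
rewrite adjmxK {1}Ae; congr (_ *m _ *m _); congr diag_mx.
by apply/rowP => j; rewrite mxE ha.
Qed.

(** The one-parameter group $t \mapsto \exp(itB)$ of the Hermitian matrix $B$ with eigenvalues [b]
    in the frame [V]. *)
Definition dpath V b : mpath R n :=
  fun t => V *m cisdiag (fun j => t * b j) *m adjmx V.

Lemma unitary_conj V A : unitary V -> unitary A -> unitary (V *m A *m adjmx V).
Proof. by move=> UV UA; do ?apply: unitaryM => //; exact: unitary_adjmx. Qed.

Lemma diag_path V (f : 'I_n -> R -> R) : unitary V ->
  (forall j, rcontin I (f j)) -> (forall j, f j 0 = 0) ->
  is_path (fun t => V *m cisdiag (f ^~ t) *m adjmx V).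
Proof.
move=> UV cf f0; apply/is_pathP; split.
- by rewrite cisdiag0 // mulmx1.
- by move=> t _; apply: unitary_conj => //; exact: unitary_cisdiag.
- apply: mcontinM; last exact: mcontin_cst.
  by apply: mcontinM; [exact: mcontin_cst|exact: mcontin_cisdiag].
Qed.

Lemma rcontin_idM c (S : set R) : rcontin S (fun t => t * c).
Proof.
by apply: rcontinM; [apply: continuous_rcontin => x; exact: cvg_id|exact: rcontin_cst].
Qed.

Lemma dpath_path V b : unitary V -> is_path (dpath V b).
Proof.
move=> UV; apply: diag_path => // j; last by rewrite mul0r.
exact: rcontin_idM.
Qed.

Lemma dpathD V a b : unitary V ->
  pmul (dpath V a) (dpath V b) = dpath V (fun j => a j + b j).
Proof.
move=> UV; apply/funext => t; rewrite /pmul /dpath.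
rewrite !mulmxA -(mulmxA _ (adjmx V) V) unitary_mulVmx // mulmx1.
rewrite -(mulmxA V) cisdiagD; congr (_ *m cisdiag _ *m _).
by apply/funext => j; rewrite mulrDr.
Qed.

Lemma dpathN V b : unitary V -> Defs.pinv (dpath V b) = dpath V (fun j => - b j).
Proof.
move=> UV; apply/funext => t; rewrite /Defs.pinv /dpath.
rewrite !adjmxM adjmxK cisdiagN mulmxA; congr (_ *m cisdiag _ *m _).
by apply/funext => j; rewrite mulrN.
Qed.

Lemma det_dpath V b t : unitary V -> \det (dpath V b t) = cis (t * \sum_j b j).
Proof.
move=> UV; rewrite /dpath !det_mulmx mulrAC -det_mulmx UV det1 mul1r det_cisdiag.
by rewrite mulr_sumr.
Qed.

(** In a fixed frame all matrices commute, so the angles can be interpolated linearly; at $t = 1$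
    the two families of angles coincide and the endpoint stays put. *)
Lemma homotopic_diag V (f : 'I_n -> R -> R) : unitary V ->
  (forall j, rcontin I (f j)) -> (forall j, f j 0 = 0) ->
  homotopic (fun t => V *m cisdiag (f ^~ t) *m adjmx V) (dpath V (f ^~ 1)).
Proof.
move=> UV cf f0; apply/homotopicP.
exists (fun s t => V *m cisdiag (fun j => f j t + s * (t * f j 1 - f j t)) *m adjmx V).
have cf2 j : rcontin (I `*` I) (fun p => f j p.2).
  apply: (@rcontin_precomp _ _ _ (I `*` I) I (fun p => p.2)) => //.
    by case=> s t [].
  exact: rcontin_snd.
split.
- apply: mcontinM; last exact: mcontin_cst.
  apply: mcontinM; first exact: mcontin_cst.
  apply: (@mcontin_cisdiag (R * R)%type (I `*` I) (fun j (p : R * R) => f j p.2 + p.1 * (p.2 * f j 1 - f j p.2))) => j.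
  apply: rcontinD => //; apply: rcontinM; first exact: rcontin_fst.
  by apply: rcontinB => //; apply: rcontinM; [exact: rcontin_snd|exact: rcontin_cst].
- by move=> s t _ _; apply: unitary_conj => //; exact: unitary_cisdiag.
- move=> t _; split; congr (_ *m cisdiag _ *m _); apply/funext => j.
    by rewrite mul0r addr0.
  by rewrite mul1r addrC subrK.
- move=> s _; split; last first.
    by congr (_ *m cisdiag _ *m _); apply/funext => j; rewrite mul1r subrr mulr0 addr0.
  by rewrite cisdiag0 ?mulmx1 // => j; rewrite f0 mul0r subrr mulr0 addr0.
Qed.

(** The frame travels from the identity to [V] along the one-parameter group through [V]. A moving
    frame would normally move the endpoint; here the endpoint is the identity, which every
    conjugation fixes. *)
Lemma dpath_frame V b : unitary V -> cisdiag b = 1%:M ->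
  homotopic (dpath 1%:M b) (dpath V b).
Proof.
move=> UV b1; have [W [a [UW Ve]]] := unitary_spectral UV.
pose P := dpath W a; have UP s : unitary (P s).
  by apply: unitary_conj => //; exact: unitary_cisdiag.
have P0 : P 0 = 1%:M by have [] := dpath_path a UW.
have P1 : P 1 = V.
  by rewrite Ve /P /dpath; congr (_ *m cisdiag _ *m _); apply/funext => j; rewrite mul1r.
apply/homotopicP; exists (fun s t => dpath (P s) b t).
split.
- have cP : mcontin (I `*` I) (fun p => P p.1).
    have /is_pathP[_ _ cP] := dpath_path a UW.
    apply: (@mcontin_precomp _ _ _ (I `*` I) I (fun p => p.1)) => //.
      by case=> s t [].
    exact: rcontin_fst.
  apply: mcontinM; last exact: mcontin_adjmx.
  apply: mcontinM => //.
  apply: (@mcontin_cisdiag (R * R)%type (I `*` I) (fun j (p : R * R) => p.2 * b j)) => j.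
  by apply: rcontinM; [exact: rcontin_snd|exact: rcontin_cst].
- by move=> s t _ _; apply: unitary_conj => //; exact: unitary_cisdiag.
- by move=> t _; rewrite P0 P1.
- have b1' : cisdiag (fun j => 1 * b j) = 1%:M.
    by rewrite -b1; congr cisdiag; apply/funext => j; rewrite mul1r.
  move=> s _; split; first by have [] := dpath_path b (UP s).
  by rewrite /dpath b1' !mulmx1 (UP s) unitary1.
Qed.

Definition delta (j : 'I_n) (x : R) : 'I_n -> R := fun i => if i == j then x else 0.

(** For a unit vector [v], multiplication by [z] on the line of [v] and the identity on its
    orthogonal complement. *)
Definition rank1rot (v : 'cV[C]_n) (z : C) : M := 1%:M + (z - 1) *: (v *m adjmx v).

Lemma unitary_rank1rot v z : adjmx v *m v = 1%:M -> z * complex.conjc z = 1 ->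
  unitary (rank1rot v z).
Proof.
move=> v1 z1; rewrite /unitary /rank1rot adjmxD adjmx1 adjmxZ adjmxM adjmxK.
rewrite mulmxDl mul1mx mulmxDr mulmx1 -!scalemxAl -!scalemxAr scalerA.
rewrite mulmxA -(mulmxA v) v1 mulmx1 -addrA; set P := v *m adjmx v.
rewrite -!scalerDl -[RHS]addr0; congr (_ + _).
have -> : complex.conjc (z - 1) = complex.conjc z - 1 by rewrite rmorphB rmorph1.
suff -> : complex.conjc z - 1 + ((z - 1) + (z - 1) * (complex.conjc z - 1)) = 0.
  by rewrite scale0r.
rewrite mulrBl mul1r mulrBr z1 mulr1; ring.
Qed.

(* The rank-one projection is rotated from the line of [j0] to that of [j1]. *)
Lemma dpath_delta_swap (j0 j1 : 'I_n) (m : int) :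
  homotopic (dpath 1%:M (delta j0 (pi *+ 2 * m%:~R)))
            (dpath 1%:M (delta j1 (pi *+ 2 * m%:~R))).
Proof.
have [->|j01] := eqVneq j0 j1.
  by apply: homotopic_refl; apply: dpath_path; exact: unitary1.
pose e j : 'cV[C]_n := delta_mx j 0.
pose v s := complex.Complex (cos (s * (pi / 2))) 0 *: e j0 +
            complex.Complex (sin (s * (pi / 2))) 0 *: e j1.
set w := pi *+ 2 * m%:~R.
have w1 : cis w = 1 by exact: cis_int.
have adje j : adjmx (e j) = delta_mx 0 j.
  apply/matrixP => p q; rewrite !mxE andbC.
  by rewrite conjc_nat.
have ee j k : adjmx (e j) *m e k = (j == k)%:R%:M.
  rewrite adje mul_delta_mx_cond; apply/matrixP => p q.
  rewrite (ord1 p) (ord1 q); case: (j == k); rewrite ?mulr0n ?mulr1n !mxE ?eqxx /=; last by rewrite mul0rn.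
  by [].
have rE j t : rank1rot (e j) (cis (t * w)) = dpath 1%:M (delta j w) t.
  rewrite /rank1rot /dpath adjmx1 mulmx1 mul1mx adje mul_delta_mx.
  apply/matrixP => p q; rewrite !mxE /delta.
  have [<-|pq] := eqVneq p q; last first.
    rewrite mulr0n add0r; have [<-|] := eqVneq p j; last by rewrite mulr0.
    by rewrite eq_sym (negbTE pq) mulr0.
  have [_|_] := eqVneq p j; last by rewrite !mulr0 cis0 addr0.
  by rewrite mulr1 mulr1n addrC subrK.
have vv s : adjmx (v s) *m v s = 1%:M.
  rewrite /v adjmxD !adjmxZ mulmxDl !mulmxDr -!scalemxAl -!scalemxAr !ee.
  rewrite !eqxx (eq_sym j1) (negbTE j01) /= !scalerA.
  have z0 : (0 : C)%:M = 0 :> 'M[C]_1 by apply/matrixP => p q; rewrite !mxE mul0rn.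
  rewrite z0 !scaler0 addr0 add0r -scalerDl.
  set x := s * (pi / 2); have := cos2Dsin2 x; rewrite !expr2 => h.
  rewrite -[RHS]scale1r; congr (_ *: _); congr complex.Complex => /=.
    by rewrite -h; ring.
  by ring.
apply/homotopicP; exists (fun s t => rank1rot (v s) (cis (t * w))); split.
- have cv : mcontin (I `*` I) (fun p => v p.1).
    have c1 : rcontin (I `*` I) (fun p => p.1 * (pi / 2)).
      by apply: rcontinM; [exact: rcontin_fst|exact: rcontin_cst].
    apply: mcontinD; apply: mcontinZ; try exact: mcontin_cst.
      by apply: ccontin_pair; [apply: rcontin_comp => //; exact: continuous_cos|exact: rcontin_cst].
    by apply: ccontin_pair; [apply: rcontin_comp => //; exact: continuous_sin|exact: rcontin_cst].
  apply: mcontinD; first exact: mcontin_cst.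
  apply: mcontinZ; last by apply: mcontinM => //; exact: mcontin_adjmx.
  apply: ccontinD; last exact: ccontin_cst.
  apply: ccontin_cis; apply: rcontinM; [exact: rcontin_snd|exact: rcontin_cst].
- by move=> s t _ _; apply: unitary_rank1rot => //; exact: cisMconj.
- move=> t _; rewrite -!rE; split; congr (rank1rot _ _); rewrite /v.
    by rewrite mul0r cos0 sin0 scale0r addr0 scale1r.
  by rewrite mul1r cos_pihalf sin_pihalf scale0r add0r scale1r.
- have dj j t : cis (t * w) = 1 -> dpath 1%:M (delta j w) t = 1%:M.
    by rewrite -rE /rank1rot => ->; rewrite subrr scale0r addr0.
  move=> s _; rewrite /rank1rot mul0r cis0 mul1r w1 subrr scale0r addr0.
  by split => //; rewrite dj // mul1r.
Qed.

(** A closed diagonal path can be brought to the standard frame, where it is a product of loops each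
    turning a single coordinate; these are moved to [j0] one by one and their winding numbers add
    up. This is the fact behind $\pi_1(U(n)) = \mathbb Z$ on which the proof relies. *)
Lemma dpath_loop V (j0 : 'I_n) (m : 'I_n -> int) : unitary V ->
  homotopic (dpath V (fun j => pi *+ 2 * (m j)%:~R))
            (dpath 1%:M (delta j0 (pi *+ 2 * (\sum_j m j)%:~R))).
Proof.
move=> UV; apply: (@homotopic_trans _ _ (dpath 1%:M (fun j => pi *+ 2 * (m j)%:~R))).
  apply: homotopic_sym; apply: dpath_frame => //.
  by rewrite -(@cisdiag0 (fun=> 0)) //; apply: eq_cisdiag => j; rewrite cis_int cis0.
have U1 := @unitary1 R n.
have -> : (fun j => pi *+ 2 * (m j)%:~R) =
    (fun i => \sum_(j <- index_enum 'I_n) delta j (pi *+ 2 * (m j)%:~R) i) :> ('I_n -> R).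
  apply/funext => i; rewrite (bigD1 i) //= /delta eqxx big1 ?addr0 //.
  by move=> j ji; rewrite eq_sym (negbTE ji).
elim: (index_enum 'I_n) => [|j r IH].
  rewrite big_nil mulr0.
  have -> : (fun i => \sum_(j <- [::]) delta j (pi *+ 2 * (m j)%:~R) i) = delta j0 0.
    by apply/funext => i; rewrite big_nil /delta; case: ifP.
  by apply: homotopic_refl; exact: dpath_path.
have -> : (fun i => \sum_(j <- j :: r) delta j (pi *+ 2 * (m j)%:~R) i) =
    (fun i => delta j (pi *+ 2 * (m j)%:~R) i +
              \sum_(j <- r) delta j (pi *+ 2 * (m j)%:~R) i).
  by apply/funext => i; rewrite big_cons.
have -> : delta j0 (pi *+ 2 * (\sum_(j <- j :: r) m j)%:~R) =
   (fun i => delta j0 (pi *+ 2 * (m j)%:~R) i +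
             delta j0 (pi *+ 2 * (\sum_(j <- r) m j)%:~R) i).
  apply/funext => i; rewrite big_cons intrD mulrDr /delta.
  by case: ifP => //; rewrite addr0.
rewrite -!dpathD //; apply: homotopicM => //.
exact: dpath_delta_swap.
Qed.

End Diagonal.

(** * Contraction of a unitary matrix to the identity by the Cayley transform *)

Section Cayley.
Variables (R : realType) (n : nat).
Local Notation C := (complex.complex R).
Local Notation M := ('M[C]_n).
Local Notation I := (@I01 R).
Implicit Types (a b : 'I_n -> R) (V W A : M) (c t : R).

(** With $K = (A - 1)(A + 1)^{-1}$ the contraction is $(1 + tK)(1 - tK)^{-1}$. Clearing $A + 1$
    leaves the numerator $(1+t)A + (1-t)$ and the present denominator $(1-t)A + (1+t)$. *)
Definition cayley_den A t : M :=
  complex.Complex (1 - t) 0 *: A + (complex.Complex (1 + t) 0)%:M.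

(* The inverse is written with the adjugate, which is continuous everywhere. *)
Definition cayley_path A t : M :=
  ((\det (cayley_den A t))^-1 *: \adj (cayley_den A t)) *m
  (complex.Complex (1 + t) 0 *: A + (complex.Complex (1 - t) 0)%:M).

(** Rotating [A] by $e^{-ic}$ moves the forbidden eigenvalue from $-1$ to $-e^{ic}$; the factor
    $e^{itc}$ undoes the rotation at $t = 1$ without disturbing the start at the identity. *)
Definition twisted_cayley c A t : M :=
  cis (t * c) *: cayley_path (cis (- c) *: A) t.

(** That is, $-e^{ic}$ is an eigenvalue of [A]. Written with a determinant, its negation is visibly
    an open condition. *)
Definition branch_point c A : Prop := \det (cis (- c) *: A + 1%:M) = 0.

(** Angle of the twisted contraction on the [j]-th eigenline. Off the branch points its value at $t
    = 1$ is the representative of [b j] modulo $2\pi$ in $(c - \pi, c + \pi)$. *)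
Definition cayley_angle c b (j : 'I_n) t : R :=
  t * c + atan (t * tan ((b j - c) / 2)) *+ 2.

Lemma conj_diagZ V z (d : 'rV[C]_n) :
  z *: (V *m diag_mx d *m adjmx V) = V *m diag_mx (z *: d) *m adjmx V.
Proof. by rewrite linearZ /= -scalemxAr -scalemxAl. Qed.

Lemma conj_diagM V (d e : 'rV[C]_n) : unitary V ->
  (V *m diag_mx d *m adjmx V) *m (V *m diag_mx e *m adjmx V) =
  V *m diag_mx (\row_j (d 0 j * e 0 j)) *m adjmx V.
Proof.
move=> UV; rewrite !mulmxA -(mulmxA _ (adjmx V) V) unitary_mulVmx // mulmx1.
by rewrite -(mulmxA V) mulmx_diag.
Qed.

Lemma conj_diag_affine V x y (d : 'rV[C]_n) : unitary V ->
  x *: (V *m diag_mx d *m adjmx V) + y%:M =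
  V *m diag_mx (\row_j (x * d 0 j + y)) *m adjmx V.
Proof.
move=> UV; have -> : y%:M = V *m diag_mx (const_mx y) *m adjmx V.
  by rewrite diag_const_mx mul_mx_scalar -scalemxAl UV scalemx1.
rewrite conj_diagZ -mulmxDl -mulmxDr -raddfD /=.
by congr (_ *m diag_mx _ *m _); apply/rowP => j; rewrite !mxE.
Qed.

Lemma det_conj_diag V (d : 'rV[C]_n) : unitary V ->
  \det (V *m diag_mx d *m adjmx V) = \prod_j d 0 j.
Proof.
by move=> UV; rewrite !det_mulmx mulrAC -det_mulmx UV det1 mul1r det_diag.
Qed.

Lemma branch_pointP V b c : unitary V ->
  ~ branch_point c (V *m cisdiag b *m adjmx V) <-> forall j, cis (b j - c) != -1.
Proof.
move=> UV; rewrite /branch_point.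
rewrite conj_diag_affine //.
rewrite det_conj_diag //; split=> [h j | h].
  apply/eqP => bj; apply: h; apply/eqP/prodf_eq0; exists j => //.
  by rewrite !mxE mulrC -cisD bj addNr.
move=> /eqP/prodf_eq0[j _]; rewrite !mxE (mulrC (cis (- c))) -cisD addr_eq0.
exact/negP/h.
Qed.

Lemma cayley_den_unit V b c t : unitary V -> (forall j, cis (b j - c) != -1) ->
  \det (cayley_den (cis (- c) *: (V *m cisdiag b *m adjmx V)) t) != 0.
Proof.
move=> UV hb.
rewrite /cayley_den conj_diagZ conj_diag_affine // det_conj_diag //.
apply/prodf_neq0 => j _; rewrite !mxE (mulrC (cis (- c))) -cisD.
by have [] := cayley_cis t (hb j).
Qed.

(** Numerator and denominator are affine in [A], so they are diagonal in the frame [V], and the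
    scalar identity [cayley_cis] applies on each eigenline. *)
Lemma twisted_cayley_diag V b c t : unitary V -> (forall j, cis (b j - c) != -1) ->
  twisted_cayley c (V *m cisdiag b *m adjmx V) t =
  V *m cisdiag (fun j => cayley_angle c b j t) *m adjmx V.
Proof.
move=> UV hb; rewrite /twisted_cayley /cayley_path.
have := cayley_den_unit t UV hb; set D := cayley_den _ _ => D0.
set N := (X in _ *m X).
have NE : N = D *m (V *m cisdiag (fun j => atan (t * tan ((b j - c) / 2)) *+ 2) *m adjmx V).
  rewrite /N /D /cayley_den (conj_diagZ V (cis (- c))).
  set d := (cis (- c) *: _); have affE x y := conj_diag_affine x y d UV.
  rewrite (affE (complex.Complex (1 + t) 0)) (affE (complex.Complex (1 - t) 0)).
  rewrite (conj_diagM _ _ UV); congr (_ *m diag_mx _ *m _); apply/rowP => j.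
  rewrite !mxE (mulrC (cis (- c))) -cisD.
  by have [_ ->] := cayley_cis t (hb j).
have DV : ((\det D)^-1 *: \adj D) *m D = 1%:M.
  by rewrite -scalemxAl mul_adj_mx scale_scalar_mx mulVf.
rewrite NE (mulmxA _ D) DV mul1mx.
rewrite conj_diagZ; congr (_ *m diag_mx _ *m _); apply/rowP => j.
by rewrite !mxE /cayley_angle [RHS]cisD.
Qed.

Lemma cis_cayley_angle c b j : cis (b j - c) != -1 -> cis (cayley_angle c b j 1) = cis (b j).
Proof.
move=> hb; have [] := cayley_cis 1 hb.
rewrite /cayley_angle !mul1r (cisD c) => _; rewrite subrr !complexr0 addr0 mul0r add0r.
have two0 : (1 + 1)%:C%C != 0 :> C by rewrite eq_complex /= negb_and -mulr2n pnatr_eq0.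
by move=> /(mulfI two0) <-; rewrite -cisD addrC subrK.
Qed.

Lemma rcontin_cayley_angle c b j : rcontin I (cayley_angle c b j).
Proof.
have cid : rcontin I id by apply: continuous_rcontin => x; exact: cvg_id.
apply: rcontinD; first by apply: rcontinM => //; exact: rcontin_cst.
under eq_fun do rewrite mulr2n.
have ca : rcontin I (fun t => atan (t * tan ((b j - c) / 2))).
  apply: rcontin_comp; first exact: continuous_atan.
  by apply: rcontinM => //; exact: rcontin_cst.
exact: rcontinD.
Qed.

Lemma homotopic_twisted_cayley V b c : unitary V -> (forall j, cis (b j - c) != -1) ->
  homotopic (twisted_cayley c (V *m cisdiag b *m adjmx V))
            (dpath V (fun j => cayley_angle c b j 1)).
Proof.
move=> UV hb.
have -> : twisted_cayley c (V *m cisdiag b *m adjmx V) =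
    (fun t => V *m cisdiag (fun j => cayley_angle c b j t) *m adjmx V).
  by apply/funext => t; exact: twisted_cayley_diag.
apply: (@homotopic_diag _ _ V (cayley_angle c b)) => // j.
  exact: rcontin_cayley_angle.
by rewrite /cayley_angle !mul0r add0r atan0 mul0rn.
Qed.

Lemma twisted_cayley_unitary c A t : unitary A -> ~ branch_point c A ->
  unitary (twisted_cayley c A t).
Proof.
move=> UA; have [V [b [UV ->]]] := unitary_spectral UA.
move=> /(branch_pointP _ _ UV) hb; rewrite twisted_cayley_diag //.
by apply: unitary_conj => //; exact: unitary_cisdiag.
Qed.

Lemma twisted_cayley0 c A : unitary A -> ~ branch_point c A ->
  twisted_cayley c A 0 = 1%:M.
Proof.
move=> UA; have [V [b [UV ->]]] := unitary_spectral UA.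
move=> /(branch_pointP _ _ UV) hb.
by have [] := homotopic_path_l (homotopic_twisted_cayley UV hb).
Qed.

Lemma twisted_cayley1 c A : unitary A -> ~ branch_point c A ->
  twisted_cayley c A 1 = A.
Proof.
move=> UA; have [V [b [UV ->]]] := unitary_spectral UA.
move=> /(branch_pointP _ _ UV) hb; rewrite twisted_cayley_diag //.
by congr (_ *m _ *m _); apply: eq_cisdiag => j; exact: cis_cayley_angle.
Qed.

(** Joint continuity in the matrix and in the time holds because the formula is rational with
    nonvanishing denominator. Diagonalization enters only to check, point by point, that the
    denominator is invertible. *)
Lemma mcontin_twisted_cayley (T : topologicalType) (S : set T) c
    (F : T -> M) (f : T -> R) :
  mcontin S F -> rcontin S f -> (forall x, S x -> unitary (F x)) ->
  (forall x, S x -> ~ branch_point c (F x)) ->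
  mcontin S (fun x => twisted_cayley c (F x) (f x)).
Proof.
move=> cF cf uF bF.
have cp : rcontin S (fun x => 1 + f x) by apply: rcontinD => //; exact: rcontin_cst.
have cm : rcontin S (fun x => 1 - f x) by apply: rcontinB => //; exact: rcontin_cst.
have c0 : rcontin S (fun x => 0 : R) by exact: rcontin_cst.
have cG : mcontin S (fun x => cis (- c) *: F x).
  by apply: mcontinZ => //; exact: ccontin_cst.
have cD : mcontin S (fun x => cayley_den (cis (- c) *: F x) (f x)).
  apply: mcontinD; first by apply: mcontinZ => //; exact: ccontin_pair.
  by apply: mcontin_scalar; exact: ccontin_pair.
apply: mcontinZ; first by apply: ccontin_cis; apply: rcontinM => //; exact: rcontin_cst.
apply: mcontinM.
  apply: mcontinZ; last exact: mcontin_adj.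
  apply: ccontinV; last exact: ccontin_det.
  move=> x Sx; have := bF x Sx; have [V [b [UV ->]]] := unitary_spectral (uF x Sx).
  by move=> /(branch_pointP _ _ UV); exact: cayley_den_unit.
apply: mcontinD; first by apply: mcontinZ => //; exact: ccontin_pair.
by apply: mcontin_scalar; exact: ccontin_pair.
Qed.

(* Pigeonhole: [n + 1] distinct angles, [n] eigenvalues. *)
Lemma not_branch_point A : unitary A -> exists c, ~ branch_point c A.
Proof.
move=> UA; have [V [b [UV ->]]] := unitary_spectral UA.
apply: contrapT => /forallNP h.
pose ang (k : 'I_n.+1) : R := (k.+1%:R)^-1.
have ang01 k : 0 < ang k <= 1.
  by rewrite /ang invr_gt0 ltr0n /= invf_le1 ?ltr0n // ler1n.
have /choice[j hj] : forall k, exists j, cis (b j - ang k) = -1.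
  move=> k; apply: contrapT => /forallNP nk; apply: (h (ang k)).
  by apply/(branch_pointP _ _ UV) => j; apply/eqP; exact: nk.
suff : injective j by move=> /leq_card; rewrite !card_ord ltnn.
move=> k l jkl.
have : cis (ang k) = cis (ang l).
  have e m : cis (ang m) = - cis (b (j m)).
    rewrite -[b (j m)](subrK (ang m)) cisD hj; ring.
  by rewrite !e jkl.
move=> /(congr1 (@complex.Re R)) /= ckl.
have in0 m : ang m \in `[0, pi]%R.
  rewrite in_itv /=; have /andP[a0 a1] := ang01 m; rewrite ltW //=.
  by apply: le_trans a1 _; apply: le_trans (pi_ge2 R); rewrite ler1n.
have /invr_inj/eqP := cos_inj (in0 k) (in0 l) ckl.
by rewrite eqr_nat eqSS => /eqP/val_inj.
Qed.

Lemma open_not_branch_point (u : R -> M) c x : mcontin I u -> I x ->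
  ~ branch_point c (u x) ->
  exists2 e, 0 < e & forall y, I y -> `|y - x| < e -> ~ branch_point c (u y).
Proof.
move=> cu Ix bx.
have cd : ccontin I (fun y => \det (cis (- c) *: u y + 1%:M)).
  apply: ccontin_det; apply: mcontinD; last exact: mcontin_cst.
  by apply: mcontinZ => //; exact: ccontin_cst.
pose d y := \det (cis (- c) *: u y + 1%:M).
(* The squared modulus turns nonvanishing of a complex number into positivity of a real one. *)
pose N y := complex.Re (d y) ^+ 2 + complex.Im (d y) ^+ 2.
have N0 y : branch_point c (u y) -> N y = 0.
  by rewrite /N /d /branch_point => ->; rewrite /= expr0n addr0.
have cN : rcontin I N.
  rewrite /N; under eq_fun do rewrite !expr2.
  by apply: rcontinD; apply: rcontinM; do ?[exact: rcontin_Re|exact: rcontin_Im].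
have Nx : 0 < N x.
  rewrite lt_neqAle addr_ge0 ?sqr_ge0 // andbT eq_sym /N paddr_eq0 ?sqr_ge0 //.
  rewrite !sqrf_eq0; apply/negP => h; apply: bx; apply/eqP.
  by rewrite eq_complex.
have N_gt : nbhs (N x) [set z : R | 0 < z] by exact: lt_nbhsr.
have /nbhs_ballP[e e0 he] : nbhs x (fun y => I y -> 0 < N y) := cN x Ix _ N_gt.
exists e; first exact: e0.
move=> y Iy yx by_.
have := he y; rewrite /ball /= distrC => /(_ yx Iy).
by rewrite (N0 _ by_) ltxx.
Qed.

End Cayley.

(** * Every path is homotopic to a one-parameter group *)

Section Classification.
Variables (R : realType) (n : nat) (j0 : 'I_n).
Local Notation C := (complex.complex R).
Local Notation M := ('M[C]_n).
Local Notation I := (@I01 R).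
Implicit Types (u v : mpath R n).

Lemma is_path_scale u s : is_path u -> I s -> is_path (fun t => u (s * t)).
Proof.
move=> /is_pathP[u0 uu cu] Is; apply/is_pathP; split; first by rewrite mulr0.
  by move=> t It; apply: uu; exact: I01M.
apply: (@mcontin_precomp _ _ _ I I ( *%R s)) => //.
  by move=> t; exact: I01M.
have : rcontin I ( *%R s); last by [].
apply: rcontinM; first exact: rcontin_cst.
by apply: continuous_rcontin => x; exact: cvg_id.
Qed.

Lemma homotopic_loops u c y z : is_path u -> I y -> I z ->
  (forall s, I s -> ~ branch_point c (u (y + s * (z - y)))) ->
  homotopic (pmul (Defs.pinv (twisted_cayley c (u y))) (fun t => u (y * t)))
            (pmul (Defs.pinv (twisted_cayley c (u z))) (fun t => u (z * t))).
Proof.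
move=> /is_pathP[u0 uu cu] Iy Iz hb.
pose sg s := y + s * (z - y).
have Isg s : I s -> I (sg s).
  by rewrite !I01E in Iy Iz * => /andP[s0 s1]; rewrite /sg; apply/andP; split; nra.
have sg0 : sg 0 = y by rewrite /sg mul0r addr0.
have sg1 : sg 1 = z by rewrite /sg mul1r addrC subrK.
have csg : rcontin (I `*` I) (fun p => sg p.1).
  apply: rcontinD; first exact: rcontin_cst.
  by apply: rcontinM; [exact: rcontin_fst|exact: rcontin_cst].
apply/homotopicP.
exists (fun s t => adjmx (twisted_cayley c (u (sg s)) t) *m u (sg s * t)); split.
- apply: mcontinM.
    apply: mcontin_adjmx; apply: mcontin_twisted_cayley.
    + apply: (@mcontin_precomp _ _ _ _ I (fun p => sg p.1) _ _ _ _ u) => //.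
      by case=> s t [/= Is _]; exact: Isg.
    + exact: rcontin_snd.
    + by case=> s t [/= Is _]; apply: uu; exact: Isg.
    + by case=> s t [/= Is _]; exact: hb.
  apply: (@mcontin_precomp _ _ _ _ I (fun p => sg p.1 * p.2) _ _ _ _ u) => //.
    by case=> s t [/= Is It]; apply: I01M => //; exact: Isg.
  by apply: rcontinM => //; exact: rcontin_snd.
- move=> s t Is It; apply: unitaryM.
    apply: unitary_adjmx; apply: twisted_cayley_unitary; last exact: hb.
    by apply: uu; exact: Isg.
  by apply: uu; apply: I01M => //; exact: Isg.
- by move=> t _; rewrite sg0 sg1.
- have loop s : I s -> adjmx (twisted_cayley c (u (sg s)) 1) *m u (sg s * 1) = 1%:M.
    move=> Is; rewrite mulr1 twisted_cayley1; last exact: hb.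
      by rewrite unitary_mulVmx //; apply: uu; exact: Isg.
    by apply: uu; exact: Isg.
  have loop0 := loop 0 (I010 R); rewrite sg0 in loop0.
  move=> s Is; split; last exact: (etrans (loop s Is) (esym loop0)).
  rewrite mulr0 u0 mulmx1 twisted_cayley0 ?adjmx1 //; last exact: hb.
  by apply: uu; exact: Isg.
Qed.

(** The property propagated in [s] concerns the piece of [u] up to [s], rescaled to the unit
    interval; for $s = 0$ this piece is constant. *)
Lemma homotopic_dpath u : is_path u ->
  exists V b, unitary V /\ homotopic u (dpath V b).
Proof.
move=> pu; have /is_pathP[u0 uu cu] := pu.
pose P s := exists V b, unitary V /\ homotopic (fun t => u (s * t)) (dpath V b).
suff : P 1.
  by move=> [V [b [UV h]]]; exists V, b; split => //; apply: homotopic_trans h;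
    apply: eq_homotopic => // t _; rewrite mul1r.
apply: (@subitv_ind _ P).
  exists 1%:M, (fun=> 0); split; first exact: unitary1.
  apply: eq_homotopic; first exact: is_path_scale.
  by move=> t _; rewrite mul0r u0 /dpath cisdiag0 ?adjmx1 ?mulmx1 // => j; rewrite mulr0.
move=> x Ix; have [c bx] := not_branch_point (uu x Ix).
have [e e0 he] := open_not_branch_point cu Ix bx.
exists e => // y z Iy Iz yx zx [V [b [UV hy]]].
have seg s : I s -> ~ branch_point c (u (y + s * (z - y))).
  rewrite I01E => /andP[s0 s1]; apply: he.
    by rewrite !I01E in Iy Iz *; apply/andP; split; nra.
  move: yx zx; rewrite !ltr_norml => /andP[y1 y2] /andP[z1 z2].
  have [yz|/ltW zy] := leP y z.
    have h1 : y <= y + s * (z - y) by nra.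
    have h2 : y + s * (z - y) <= z by nra.
    by apply/andP; split; lra.
  have h1 : y + s * (z - y) <= y by nra.
  have h2 : z <= y + s * (z - y) by nra.
  by apply/andP; split; lra.
have by_ : ~ branch_point c (u y) by exact: he.
have bz : ~ branch_point c (u z) by exact: he.
have uy : u y = V *m cisdiag b *m adjmx V.
  have := homotopic_end hy; rewrite mulr1 => <-; rewrite /dpath.
  by congr (_ *m cisdiag _ *m _); apply/funext => j; rewrite mul1r.
have hb : forall j, cis (b j - c) != -1 by apply/(branch_pointP _ _ UV); rewrite -uy.
have hty : homotopic (twisted_cayley c (u y)) (dpath V (fun j => cayley_angle c b j 1)).
  by rewrite uy; exact: homotopic_twisted_cayley.
(* The contraction and the normal form both end at [u y], so in the frame [V] their angles differ by
   multiples of $2\pi$. *)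
have /choice[m hm] : forall j, exists m : int, b j - cayley_angle c b j 1 = pi *+ 2 * m%:~R.
  by move=> j; apply: cis_eq_int; rewrite cis_cayley_angle.
set l := pmul (Defs.pinv (twisted_cayley c (u y))) (fun t => u (y * t)).
pose L : 'I_n -> R := delta j0 (pi *+ 2 * (\sum_j m j)%:~R).
have hl : homotopic l (dpath 1%:M L).
  apply: (homotopic_trans _ (dpath_loop j0 m UV)).
  have := homotopicM (homotopicV hty) hy; rewrite (dpathN _ UV) (dpathD _ _ UV).
  suff -> : (fun j => - cayley_angle c b j 1 + b j) = (fun j => pi *+ 2 * (m j)%:~R) by [].
  by apply/funext => j; rewrite addrC hm.
have [W [d [UW uz]]] := unitary_spectral (uu z Iz).
have hd : forall j, cis (d j - c) != -1 by apply/(branch_pointP _ _ UW); rewrite -uz.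
have htz : homotopic (twisted_cayley c (u z)) (dpath W (fun j => cayley_angle c d j 1)).
  by rewrite uz; exact: homotopic_twisted_cayley.
have hlz := homotopic_trans (homotopic_sym (homotopic_loops pu Iy Iz seg)) hl.
(* The eigenframe [W] of [u z] is unrelated to [V]. Being closed, the comparison loop can be carried
   to [W], where it is simultaneously diagonal with the contraction and the angles add. *)
have LW : homotopic (dpath 1%:M L) (dpath W L).
  apply: dpath_frame => //; rewrite -(@cisdiag0 _ _ (fun=> 0)) //.
  apply: eq_cisdiag => j; rewrite /L /delta; case: ifP => // _.
  by rewrite cis_int cis0.
exists W, (fun j => cayley_angle c d j 1 + L j); split; first exact: UW.
rewrite -(dpathD _ _ UW).
apply: homotopic_trans (homotopicM htz (homotopic_trans hlz LW)).
apply: eq_homotopic; first exact: is_path_scale.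
move=> t It; rewrite /pmul /Defs.pinv mulmxA.
by rewrite twisted_cayley_unitary ?mul1mx //; exact: uu.
Qed.

(* All the winding is moved to the coordinate [j0]. *)
Lemma homotopic_dpath_ge0 V (b : 'I_n -> R) : unitary V ->
  pi *+ 2 * n%:R <= \sum_j b j ->
  exists b', (forall j, 0 <= b' j) /\ homotopic (dpath V b) (dpath V b').
Proof.
move=> UV hb; have p0 : (0 : R) < pi *+ 2 by rewrite mulrn_wgt0 ?pi_gt0.
pose k j := Num.floor (b j / (pi *+ 2)).
(* Every angle except that of [j0] is reduced into $[0, 2\pi)$; the value at [j0] makes the total
   zero, so that the added loop is null-homotopic. *)
pose m j : int := if j == j0 then \sum_(i | i != j0) k i else - k j.
have m0 : \sum_j m j = 0.
  rewrite (bigD1 j0) //= {1}/m eqxx -big_split /= big1 // => j jj0.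
  by rewrite /m (negbTE jj0) subrr.
have kb j : 0 <= b j - pi *+ 2 * (k j)%:~R < pi *+ 2.
  have h1 : (k j)%:~R <= b j / (pi *+ 2) by exact: floor_le_tmp.
  have h2 : b j / (pi *+ 2) < (k j)%:~R + 1 by rewrite -intrD1 floorD1_gt.
  rewrite ler_pdivlMr // in h1; rewrite ltr_pdivrMr // in h2.
  by apply/andP; split; lra.
exists (fun j => b j + pi *+ 2 * (m j)%:~R); split.
  move=> j; rewrite /m; case: eqP => [->|_]; last first.
    by rewrite mulrNz mulrN; have /andP[] := kb j.
  have -> : b j0 + pi *+ 2 * (\sum_(i | i != j0) k i)%:~R =
     \sum_j b j - \sum_(i | i != j0) (b i - pi *+ 2 * (k i)%:~R).
    rewrite [\sum_j b j](bigD1 j0) //= -addrA; congr (_ + _).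
    rewrite sumrB opprB addrC subrK raddf_sum /= mulr_sumr.
    by apply: eq_bigr.
  (* The reduced angles other than that of [j0] add up to at most $2\pi n$, and the hypothesis
     leaves a nonnegative remainder for [j0]. *)
  rewrite subr_ge0; apply: le_trans hb.
  apply: (@le_trans _ _ (\sum_(i < n) pi *+ 2)); last first.
    by rewrite sumr_const card_ord mulr_natr.
  rewrite [leRHS](bigD1 j0) //= -[leLHS]add0r; apply: lerD; first exact: ltW.
  by apply: ler_sum => i _; have /andP[_ /ltW] := kb i.
rewrite -(dpathD _ _ UV).
have hl := dpath_loop j0 m UV; rewrite m0 mulr0 in hl.
have one t : dpath 1%:M (delta j0 0) t = 1%:M :> M.
  rewrite /dpath cisdiag0 ?adjmx1 ?mulmx1 // => j.
  by rewrite /delta; case: ifP => _; rewrite mulr0.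
apply: homotopic_trans (homotopicM (homotopic_refl (dpath_path b UV)) (homotopic_sym hl)).
by apply: eq_homotopic => [|t _]; [exact: dpath_path|rewrite /pmul one mulmx1].
Qed.

End Classification.

(** * Uniqueness and homotopy invariance of the winding of the determinant *)

Section Index.
Variables (R : realType).
Local Notation C := (complex.complex R).
Local Notation I := (@I01 R).

(** A continuous choice of argument on the right half of the unit circle; it supplies the correction
    between nearby lifts. *)
Lemma cis_atan_div (z : C) : z * complex.conjc z = 1 -> 0 < complex.Re z ->
  cis (atan (complex.Im z / complex.Re z)) = z.
Proof.
case: z => x y /(congr1 (@complex.Re R)) /= xy x0.
have {}xy : 1 + (y / x) ^+ 2 = (x^-1) ^+ 2.
  have -> : 1 + (y / x) ^+ 2 = (x * x - y * - y) * (x^-1) ^+ 2.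
    by field; rewrite gt_eqF.
  by rewrite xy mul1r.
rewrite cis_atan cos_atan xy sqrtr_sqr gtr0_norm ?invr_gt0 // invrK.
congr complex.Complex => /=; first by ring.
by field; rewrite gt_eqF.
Qed.

Lemma near_I01 (Q : R -> Prop) x : nbhs x (fun y => I y -> Q y) ->
  exists2 e, 0 < e & forall y, I y -> `|y - x| < e -> Q y.
Proof.
move=> /nbhs_ballP[e e0 he]; exists e; first exact: e0.
by move=> y Iy yx; apply: (he y) => //; rewrite /ball /= distrC.
Qed.

Lemma rcontin_close (f : R -> R) x r : rcontin I f -> I x -> 0 < r ->
  exists2 e, 0 < e & forall y, I y -> `|y - x| < e -> `|f y - f x| < r.
Proof.
move=> cf Ix r0; apply: near_I01.
have nr : nbhs (f x) [set z : R | `|z - f x| < r].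
  by apply/nbhs_ballP; exists r => // z; rewrite /ball /= distrC.
exact: (cf x Ix _ nr).
Qed.

Lemma lift_unique (th1 th2 : R -> R) : rcontin I th1 -> rcontin I th2 ->
  (forall t, I t -> cis (th1 t) = cis (th2 t)) ->
  th1 1 - th1 0 = th2 1 - th2 0.
Proof.
move=> c1 c2 e12; pose d t := th1 t - th2 t.
have cd : rcontin I d by exact: rcontinB.
suff : d 1 = d 0 by rewrite /d => h; lra.
apply: (@subitv_ind _ (fun t => d t = d 0)) => // x Ix.
(* With radius $\pi$ two nearby values of [d] differ by less than $2\pi$; as their difference is a
   multiple of $2\pi$, it is zero. *)
have [e e0 he] := rcontin_close cd Ix (pi_gt0 R).
exists e => // y z Iy Iz yx zx <-.
have [m hm] : exists m : int, d z - d y = pi *+ 2 * m%:~R.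
  have [m1 h1] := cis_eq_int (e12 z Iz); have [m2 h2] := cis_eq_int (e12 y Iy).
  by exists (m1 - m2); rewrite /d h1 h2 intrB mulrBr.
have dzy : `|d z - d y| < pi *+ 2.
  have := he y Iy yx; have := he z Iz zx; rewrite !ltr_norml mulr2n.
  by move=> /andP[? ?] /andP[? ?]; apply/andP; split; lra.
suff m0 : m = 0 by apply/eqP; rewrite -subr_eq0 hm m0 mulr0.
move: dzy; rewrite hm normrM gtr0_norm; last by rewrite mulrn_wgt0 ?pi_gt0.
rewrite -[ltRHS]mulr1 ltr_pM2l; last by rewrite mulrn_wgt0 ?pi_gt0.
rewrite -intr_norm -[1]/(1%:~R) ltr_int -[X in _ < X]add0r ltzD1 normr_le0.
by move=> /eqP.
Qed.

Section HomotopyLifting.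
Variable d : R -> R -> C.
Hypothesis cd : ccontin (I `*` I) (fun p => d p.1 p.2).
Hypothesis d1 : forall s t, I s -> I t -> d s t * complex.conjc (d s t) = 1.
Hypothesis dend : forall s, I s -> d s 0 = d 0 0 /\ d s 1 = d 0 1.

Let q s s' t : C := d s t * complex.conjc (d s' t).

Let ccontin_slice s : I s -> ccontin I (d s).
Proof.
move=> Is; apply: (@ccontin_precomp _ _ _ I (I `*` I) (fun t => (s, t)) _ _ _ cd) => //.
apply: rcontin_pair; first exact: rcontin_cst.
by apply: continuous_rcontin => x; exact: cvg_id.
Qed.

(** A tube lemma: the closeness of the slices at [s] and [x] is uniform in [t]. The bound [b] on [t]
    is pushed from 0 to 1; at 0 the slices agree because the endpoints are fixed. *)
Let quotient_near x : I x -> exists2 e, 0 < e &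
  forall s, I s -> `|s - x| < e -> forall t, I t -> 0 < complex.Re (q s x t).
Proof.
move=> Ix; pose Q b := exists2 e, 0 < e & forall s, I s -> `|s - x| < e ->
  forall t, I t -> t <= b -> 0 < complex.Re (q s x t).
suff : Q 1.
  move=> [e e0 he]; exists e => // s Is sx t It; apply: he => //.
  by move: It; rewrite I01E => /andP[].
have qx t : I t -> q x x t = 1 by move=> It; exact: d1.
apply: (@subitv_ind _ Q).
  exists 1 => // s Is _ t It t0.
  have -> : t = 0 by apply/le_anti; rewrite t0; move: It; rewrite I01E => /andP[].
  have e0 := (dend Is).1; have e0' := (dend Ix).1.
  by rewrite /q e0 -e0' d1 ?ltr01.
move=> t0 It0.
have cq : rcontin (I `*` I) (fun p => complex.Re (q p.1 x p.2)).
  apply: rcontin_Re; apply: ccontinM => //; apply: ccontin_conj.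
  apply: (@ccontin_precomp _ _ _ (I `*` I) I (fun p => p.2)) => //.
  - by case=> s t [].
  - exact: rcontin_snd.
  - exact: ccontin_slice.
have ngt : nbhs (complex.Re (q x x t0)) [set z : R | 0 < z].
  by rewrite qx //; apply: lt_nbhsr; exact: ltr01.
have /nbhs_ballP[e e0 he] : nbhs (x, t0)
    (fun p => (I `*` I) p -> 0 < complex.Re (q p.1 x p.2)) := cq (x, t0) (conj Ix It0) _ ngt.
exists e; first exact: e0.
move=> y z Iy Iz yt zt [e' e'0 he']; exists (Num.min e e').
  by rewrite lt_min e0 e'0.
move=> s Is; rewrite lt_min => /andP[se se'] t It tz.
have [ty|yt'] := leP t y; first exact: he'.
apply: (he (s, t)); last by split.
split; rewrite /ball /= distrC //.
move: yt zt; rewrite !ltr_norml => /andP[? ?] /andP[? ?]; apply/andP; split; lra.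
Qed.

(** A lift of one slice becomes a lift of a nearby slice after adding the principal argument of the
    quotient [q]. The quotient is 1 at both ends, so the increment of the lift does not change. *)
Lemma homotopy_lifting (th : R -> R) : rcontin I th ->
  (forall t, I t -> d 0 t = cis (th t)) ->
  exists th', [/\ rcontin I th', forall t, I t -> d 1 t = cis (th' t)
                & th' 1 - th' 0 = th 1 - th 0].
Proof.
move=> cth hth.
pose P s := exists th', [/\ rcontin I th', forall t, I t -> d s t = cis (th' t)
                & th' 1 - th' 0 = th 1 - th 0].
have step s s' : I s -> I s' -> (forall t, I t -> 0 < complex.Re (q s s' t)) ->
    P s' -> P s.
  move=> Is Is' q0 [th' [cth' hth' eth']].
  pose a t := atan (complex.Im (q s s' t) / complex.Re (q s s' t)).
  have cq : ccontin I (q s s').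
    by apply: ccontinM; [exact: ccontin_slice|apply: ccontin_conj; exact: ccontin_slice].
  have ca : rcontin I a.
    apply: rcontin_comp; first exact: continuous_atan.
    apply: rcontinM; first exact: rcontin_Im.
    move=> t It; apply: cvgV; first by rewrite gt_eqF // q0.
    exact: (rcontin_Re cq).
  have a0 t : q s s' t = 1 -> a t = 0 by rewrite /a => -> /=; rewrite mul0r atan0.
  exists (fun t => th' t + a t); split.
  - exact: rcontinD.
  - move=> t It; rewrite cisD cis_atan_div; last exact: q0.
      by rewrite -hth' // /q mulrCA d1 // mulr1.
    rewrite /q rmorphM /= conjcK mulrACA d1 // mul1r mulrC d1 //.
  - have [s0 s1] := dend Is; have [s0' s1'] := dend Is'.
    rewrite !a0 ?addr0 // /q; first by rewrite s0 -s0' d1.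
    by rewrite s1 -s1' d1.
suff : P 1 by [].
apply: (@subitv_ind _ P); first by exists th.
move=> x Ix; have [e e0 he] := quotient_near Ix.
exists e => // y z Iy Iz yx zx Py.
(* Both [y] and [z] are only known to be close to [x], so the lift passes through the slice at [x];
   the real part of [q] is symmetric in the two slices. *)
apply: (step z x) => //; first exact: he.
apply: (step x y) => // t It.
have := he y Iy yx t It; rewrite /q.
by case: (d x t) => ? ?; case: (d y t) => ? ? /=; lra.
Qed.

End HomotopyLifting.

Lemma det_liftP n (u : mpath R n) th : det_lift u th <->
  rcontin I th /\ forall t, I t -> \det (u t) = cis (th t).
Proof. by split=> -[/within_continuousP h1 h2]; split => //; apply/within_continuousP. Qed.

Lemma homotopic_det_lift n (u v : mpath R n) th : homotopic u v -> det_lift u th ->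
  exists2 th', det_lift v th' & th' 1 - th' 0 = th 1 - th 0.
Proof.
move=> huv /det_liftP[cth hth]; have e := homotopic_end huv.
move: huv => /homotopicP[H [cH uH He Hs]].
have [|||||th' [cth' hth' eth']] := @homotopy_lifting (fun s t => \det (H s t)) _ _ _ th.
- exact: ccontin_det.
- by move=> s t Is It; apply: unitary_det; exact: uH.
- by move=> s Is; have [-> ->] := Hs s Is; have [-> ->] := Hs 0 (I010 R).
- by [].
- by move=> t It; have [-> _] := He t It; exact: hth.
exists th' => //; apply/det_liftP; split => // t It.
by rewrite -hth' //; have [_ ->] := He t It.
Qed.

Lemma det_lift_unique n (u : mpath R n) th1 th2 : det_lift u th1 -> det_lift u th2 ->
  th1 1 - th1 0 = th2 1 - th2 0.
Proof.
move=> /det_liftP[c1 h1] /det_liftP[c2 h2]; apply: lift_unique => // t It.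
by rewrite -h1 // h2.
Qed.

End Index.

(** * Linear coefficient of a determinant *)

Section Determinant.
Variable F : comNzRingType.

Lemma coef1M (p q : {poly F}) : (p * q)`_1 = p`_0 * q`_1 + p`_1 * q`_0.
Proof. by rewrite coefM big_ord_recl big_ord_recl big_ord0 addr0. Qed.

Lemma coef_prod_affine (I : Type) (r : seq I) (a : I -> F) :
  (\prod_(i <- r) (1 + 'X * (a i)%:P))`_0 = 1 /\
  (\prod_(i <- r) (1 + 'X * (a i)%:P))`_1 = \sum_(i <- r) a i.
Proof.
elim: r => [|i r [IH0 IH1]]; first by rewrite !big_nil !coefC.
rewrite !big_cons coef0M coef1M IH0 IH1 !coefD !coefXM !coefC /=.
by rewrite addr0 !mulr1 mul1r add0r addrC.
Qed.

(** A permutation other than the identity moves some [i], and then also [s i]; the two off-diagonal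
    entries each carry a factor ['X], so only the identity contributes in degree 1. *)
Lemma coef1_det_affine n (K : 'M[F]_n) :
  (\det (1%:M + 'X *: map_mx polyC K))`_1 = \tr K.
Proof.
have cE i j : (1%:M + 'X *: map_mx polyC K) i j = (i == j)%:R + 'X * (K i j)%:P.
  by rewrite !mxE.
rewrite /determinant coef_sum (bigD1 (1%g : {perm 'I_n})) //= [X in _ + X]big1 ?addr0.
  rewrite odd_perm1 expr0 mul1r.
  rewrite (eq_bigr (fun i => 1 + 'X * (K i i)%:P)); last first.
    by move=> i _; rewrite perm1 cE eqxx.
  exact: (coef_prod_affine _ _).2.
move=> s s1; have [i si] : exists i, s i != i.
  apply/existsP; apply: contraNT s1 => /existsPn h.
  by apply/eqP/permP => i; rewrite perm1; apply/eqP; have := h i; rewrite negbK.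
rewrite (bigD1 i) //= (bigD1 (s i)) //= !cE.
rewrite (inj_eq perm_inj) eq_sym (negbTE si) !add0r -!mulrA.
by rewrite mulr_sign; case: (odd_perm s); rewrite ?coefN coefXM /= coef0M coefXM mulr0 ?oppr0.
Qed.

End Determinant.

(** * Complex derivatives and Jacobi's formula *)

Section Derivative.
Variable R : realType.
Local Notation C := (complex.complex R).
Local Notation re := (@complex.Re R).
Local Notation im := (@complex.Im R).

Definition cder (f : R -> C) (t : R) (l : C) : Prop :=
  is_derive t 1 (fun s => re (f s)) (re l) /\ is_derive t 1 (fun s => im (f s)) (im l).

Lemma cder_cst a t : cder (fun=> a) t 0.
Proof. by split => /=; exact: is_derive_cst. Qed.

Lemma cderD f g t a b : cder f t a -> cder g t b -> cder (fun s => f s + g s) t (a + b).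
Proof.
move=> [f1 f2] [g1 g2]; split.
  have -> : (fun s => re (f s + g s)) = (fun s => re (f s)) + (fun s => re (g s)).
    by apply/funext => s; rewrite fctE; case: (f s); case: (g s).
  have -> : re (a + b) = re a + re b by case: (a); case: (b).
  exact: is_deriveD.
have -> : (fun s => im (f s + g s)) = (fun s => im (f s)) + (fun s => im (g s)).
  by apply/funext => s; rewrite fctE; case: (f s); case: (g s).
have -> : im (a + b) = im a + im b by case: (a); case: (b).
exact: is_deriveD.
Qed.

Lemma cderM f g t a b : cder f t a -> cder g t b ->
  cder (fun s => f s * g s) t (f t * b + a * g t).
Proof.
move=> [f1 f2] [g1 g2]; split.
  have -> : (fun s => re (f s * g s)) =
      (fun s => re (f s)) * (fun s => re (g s)) - (fun s => im (f s)) * (fun s => im (g s)).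
    by apply/funext => s; rewrite !fctE; case: (f s); case: (g s).
  apply: is_derive_eq (is_deriveB (is_deriveM f1 g1) (is_deriveM f2 g2)) _.
  move: (f t) (g t) => u v; case: u; case: v; case: (a); case: (b) => * /=.
  rewrite /GRing.scale /=; ring.
have -> : (fun s => im (f s * g s)) =
    (fun s => re (f s)) * (fun s => im (g s)) + (fun s => im (f s)) * (fun s => re (g s)).
  by apply/funext => s; rewrite !fctE; case: (f s); case: (g s).
apply: is_derive_eq (is_deriveD (is_deriveM f1 g2) (is_deriveM f2 g1)) _.
move: (f t) (g t) => u v; case: u; case: v; case: (a); case: (b) => * /=.
rewrite /GRing.scale /=; ring.
Qed.

Lemma cder_sum (J : Type) (r : seq J) (f : J -> R -> C) (l : J -> C) t :
  (forall j, cder (f j) t (l j)) ->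
  cder (fun s => \sum_(j <- r) f j s) t (\sum_(j <- r) l j).
Proof.
move=> fl; elim: r => [|j r IH].
  by under eq_fun do rewrite big_nil; rewrite big_nil; exact: cder_cst.
by under eq_fun do rewrite big_cons; rewrite big_cons; exact: cderD.
Qed.

Lemma cder_cis b t : cder (fun s => cis (s * b)) t (complex.Complex 0 b * cis (t * b)).
Proof.
have db : is_derive t 1 (fun s : R => s * b) b.
  by apply: is_derive_eq; rewrite /GRing.scale /=; ring.
have dc := @is_derive1_comp _ _ (fun s : R => s * b) _ _ _ (is_derive_cos (t * b)) db.
have ds := @is_derive1_comp _ _ (fun s : R => s * b) _ _ _ (is_derive_sin (t * b)) db.
split; [rewrite /= mul0r sub0r mulrC -mulNr|rewrite /= mul0r add0r mulrC].
  exact: dc.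
exact: ds.
Qed.

(* The value and the derivative of [f] at [t] are the first two coefficients
   of [p], i.e. a dual number. *)
Definition dual (f : R -> C) (t : R) (p : {poly C}) : Prop :=
  f t = p`_0 /\ cder f t p`_1.

Lemma dual_cst a t : dual (fun=> a) t a%:P.
Proof. by split; rewrite coefC //; exact: cder_cst. Qed.

Lemma dualD f g t p q : dual f t p -> dual g t q -> dual (fun s => f s + g s) t (p + q).
Proof.
by move=> [f0 f1] [g0 g1]; split; rewrite coefD; [rewrite f0 g0|exact: cderD].
Qed.

Lemma dualM f g t p q : dual f t p -> dual g t q -> dual (fun s => f s * g s) t (p * q).
Proof.
move=> [f0 f1] [g0 g1]; split; first by rewrite coef0M f0 g0.
by rewrite coef1M -f0 -g0; exact: cderM.
Qed.

Lemma dual_sum (J : Type) (r : seq J) (f : J -> R -> C) p t :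
  (forall j, dual (f j) t (p j)) ->
  dual (fun s => \sum_(j <- r) f j s) t (\sum_(j <- r) p j).
Proof.
move=> fl; elim: r => [|j r IH].
  by under eq_fun do rewrite big_nil; rewrite big_nil -polyC0; exact: dual_cst.
by under eq_fun do rewrite big_cons; rewrite big_cons; exact: dualD.
Qed.

Lemma dual_prod (J : Type) (r : seq J) (f : J -> R -> C) p t :
  (forall j, dual (f j) t (p j)) ->
  dual (fun s => \prod_(j <- r) f j s) t (\prod_(j <- r) p j).
Proof.
move=> fl; elim: r => [|j r IH].
  by under eq_fun do rewrite big_nil; rewrite big_nil -polyC1; exact: dual_cst.
by under eq_fun do rewrite big_cons; rewrite big_cons; exact: dualM.
Qed.

Lemma dual_det n (w : R -> 'M[C]_n) (P : 'M[{poly C}]_n) t :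
  (forall i j, dual (fun s => w s i j) t (P i j)) ->
  dual (fun s => \det (w s)) t (\det P).
Proof.
move=> wP; apply: dual_sum => s; apply: dualM; last exact: dual_prod.
have -> : (-1) ^+ odd_perm s = ((-1) ^+ odd_perm s)%:P :> {poly C}.
  by rewrite rmorphXn /= rmorphN.
exact: dual_cst.
Qed.

Variable n : nat.

Lemma cder_mderiv (w : mpath R n) t i j : is_C1 w -> cder (fun s => w s i j) t (mderiv w t i j).
Proof.
move=> /(_ i j) [d1 [d2 _]]; rewrite mxE.
by split; rewrite /= derive1E; exact/derivableP.
Qed.

(** Over dual numbers $w + X w'$ factors as $w (1 + X w^{-1} w')$ with $w^{-1}$ the adjoint, so the
    linear coefficient is $\det w$ times the trace of $w^{-1} w'$, which equals that of $w' w^{-1} =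
    ih$. *)
Lemma cder_det (w : mpath R n) t : is_C1 w -> unitary (w t) ->
  cder (fun s => \det (w s)) t (\det (w t) * (complex.Complex 0 1 * \tr (hgen w t))).
Proof.
move=> cw uw; have := fun i j => cder_mderiv t i j cw.
rewrite /hgen; move: (mderiv w t) => W cW.
pose P := map_mx polyC (w t) + 'X *: map_mx polyC W.
have [] := @dual_det _ w P t _.
  by move=> i j; split; rewrite /P !mxE coefD coefXM !coefC /= ?addr0 ?add0r.
move=> _; suff -> : (\det P)`_1 = \det (w t) *
    (complex.Complex 0 1 * \tr (- complex.Complex 0 1 *: (W *m adjmx (w t)))) by [].
have -> : P = map_mx polyC (w t) *m (1%:M + 'X *: map_mx polyC (adjmx (w t) *m W)).
  by rewrite mulmxDr mulmx1 -scalemxAr -map_mxM mulmxA uw mul1mx.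
rewrite det_mulmx det_map_mx coefCM coef1_det_affine mxtrace_mulC; congr (_ * _).
rewrite mxtraceZ mulrA.
suff -> : complex.Complex 0 1 * - complex.Complex 0 1 = 1 :> C by rewrite mul1r.
by congr complex.Complex => /=; ring.
Qed.

End Derivative.

(** * Monotonicity of determinant lifts; generators of one-parameter groups *)

Section Monotone.
Variables (R : realType) (n : nat).
Local Notation C := (complex.complex R).
Local Notation re := (@complex.Re R).
Local Notation im := (@complex.Im R).
Local Notation I := (@I01 R).
Implicit Types (w : mpath R n) (V : 'M[C]_n) (b : 'I_n -> R).

(** A lift is a priori only continuous. Near [t] it stays within $\pi/2$ of [th t], so it equals
    [th t] plus the arcsine of the imaginary part of $\det w(s)\,\overline{\det w(t)}$, which is
    differentiable. *)
Lemma is_derive_det_lift w th (t : R) : is_C1 w -> (forall s, I s -> unitary (w s)) ->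
  det_lift w th -> 0 < t < 1 -> is_derive t 1 th (re (\tr (hgen w t))).
Proof.
move=> cw uw /det_liftP[cth hth] /andP[t0 t1].
have It : I t by rewrite I01E !ltW.
have nI : nbhs t I.
  have /near_in_itvoo : t \in `]0, 1[%R by rewrite in_itv /= t0 t1.
  by apply: filterS => s; rewrite in_itv /= I01E => /andP[/ltW -> /ltW ->].
pose G s := im (\det (w s) * complex.conjc (\det (w t))).
have dG : is_derive t 1 G (re (\tr (hgen w t))).
  have := cderM (cder_det cw (uw t It)) (cder_cst (complex.conjc (\det (w t))) t).
  rewrite mulr0 add0r mulrAC (unitary_det (uw t It)) mul1r => -[_].
  suff -> : im (complex.Complex 0 1 * \tr (hgen w t)) = re (\tr (hgen w t)) by [].
  by case: (\tr _) => x y /=; ring.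
have Gt : G t = 0 by rewrite /G (unitary_det (uw t It)).
have Gs s : I s -> G s = sin (th s - th t).
  move=> Is; rewrite /G !hth // -cisN -cisD //.
have d_asin : is_derive t 1 (fun s => th t + asin (G s)) (re (\tr (hgen w t))).
  have da : is_derive (G t) 1 (@asin R) 1.
    have := @is_derive1_asin R (G t).
    rewrite Gt expr0n subr0 sqrtr1 invr1; apply.
    by rewrite ltrN10 ltr01.
  have dc := @is_derive1_comp _ _ G _ _ _ da dG.
  have := is_deriveD (is_derive_cst (th t) t 1) dc.
  by rewrite mul1r add0r.
apply: (near_eq_is_derive _ d_asin).
have pi2 : 0 < pi / 2 :> R by rewrite divr_gt0 ?pi_gt0.
have [e e0 he] := rcontin_close cth It pi2.
have : nbhs t (fun s => I s /\ `|s - t| < e).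
  apply: filterI => //; apply/nbhs_ballP; exists e; first exact: e0.
  by move=> s; rewrite /ball /= distrC.
apply: filterS => s [Is st].
have sK : asin (sin (th s - th t)) = th s - th t.
  apply: sinK; have := he s Is st; rewrite ltr_norml in_itv /= => /andP[h1 h2].
  by rewrite (ltW h1) (ltW h2).
by rewrite (Gs s Is) sK addrC subrK.
Qed.

Lemma adjmx_delta j : adjmx (delta_mx j 0 : 'cV[C]_n) = delta_mx 0 j.
Proof. by apply/matrixP => p q; rewrite !mxE andbC conjc_nat. Qed.

Lemma quad_delta (A : 'M[C]_n) j :
  (adjmx (delta_mx j 0 : 'cV[C]_n) *m A *m (delta_mx j 0 : 'cV[C]_n)) 0 0 = A j j.
Proof. by rewrite adjmx_delta -rowE -colE !mxE. Qed.

(** Diagonal entries are the values of the quadratic form at the basis vectors. *)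
Lemma psd_trace (A : 'M[C]_n) : psd A -> 0 <= re (\tr A).
Proof.
move=> [_ pA]; have : 0 <= \tr A.
  by apply: sumr_ge0 => j _; rewrite -quad_delta.
by rewrite lecE => /andP[].
Qed.

Lemma pd_trace (A : 'M[C]_n) : (0 < n)%N -> pd A -> 0 < re (\tr A).
Proof.
move=> n0 [_ pA]; have dA j : 0 < A j j.
  rewrite -quad_delta; apply: pA; apply/eqP => /matrixP/(_ j 0).
  by rewrite !mxE !eqxx => /eqP; rewrite oner_eq0.
have : 0 < \tr A.
  rewrite /mxtrace (bigD1 (Ordinal n0)) //= ltr_pwDl //.
  by apply: sumr_ge0 => j _; exact: ltW.
by rewrite ltcE => /andP[].
Qed.

Lemma det_lift_nondecreasing w th : is_C1 w -> (forall s, I s -> unitary (w s)) ->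
  det_lift w th -> (forall t, I t -> psd (hgen w t)) -> th 0 <= th 1.
Proof.
move=> cw uw lw hp; have cth := lw.1.
have dth (x : R) : x \in `]0, 1[%R -> is_derive x 1 th (re (\tr (hgen w x))).
  by rewrite in_itv /=; exact: is_derive_det_lift.
apply: (@ger0_derive1_le_cc R th 0 1) => //; rewrite ?in_itv /= ?lexx ?ler01 //.
- by move=> x /dth dx; exact: ex_derive.
- move=> x x01; have dx := dth x x01; rewrite derive1E derive_val psd_trace //.
  by apply: hp; move: x01; rewrite in_itv /= I01E => /andP[/ltW -> /ltW ->].
Qed.

Lemma det_lift_increasing w th : (0 < n)%N -> is_C1 w -> (forall s, I s -> unitary (w s)) ->
  det_lift w th -> (forall t, I t -> pd (hgen w t)) -> th 0 < th 1.
Proof.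
move=> n0 cw uw lw hp; have cth := lw.1.
have dth (x : R) : x \in `]0, 1[%R -> is_derive x 1 th (re (\tr (hgen w x))).
  by rewrite in_itv /=; exact: is_derive_det_lift.
apply: (@gtr0_derive1_lt_cc R th 0 1) => //; rewrite ?in_itv /= ?lexx ?ler01 ?ltr01 //.
- by move=> x /dth dx; exact: ex_derive.
- move=> x x01; have dx := dth x x01; rewrite derive1E derive_val pd_trace //.
  by apply: hp; move: x01; rewrite in_itv /= I01E => /andP[/ltW -> /ltW ->].
Qed.

Lemma rcontin_setT (f : R -> R) : rcontin setT f -> continuous f.
Proof.
move=> cf x V nV.
have : nbhs x (fun y => setT y -> V (f y)) := cf x Logic.I V nV.
by apply: filterS => y; apply.
Qed.

Lemma conj_diagE V (d : 'rV[C]_n) i k :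
  (V *m diag_mx d *m adjmx V) i k = \sum_j V i j * d 0 j * complex.conjc (V k j).
Proof. by rewrite mul_mx_diag mxE; apply: eq_bigr => j _; rewrite !mxE. Qed.

Lemma cder_dpath V b t i k : cder (fun s => dpath V b s i k) t
  ((V *m diag_mx (\row_j (complex.Complex 0 (b j) * cis (t * b j))) *m adjmx V) i k).
Proof.
rewrite conj_diagE.
have -> : (fun s => dpath V b s i k) =
    (fun s => \sum_j V i j * cis (s * b j) * complex.conjc (V k j)).
  by apply/funext => s; rewrite conj_diagE; apply: eq_bigr => j _; rewrite mxE.
apply: cder_sum => j; rewrite mxE.
have := cderM (cderM (cder_cst (V i j) t) (cder_cis (b j) t)) (cder_cst (complex.conjc (V k j)) t).
by rewrite mulr0 add0r mul0r addr0.
Qed.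

Lemma mderiv_dpath V b t : mderiv (dpath V b) t =
  V *m diag_mx (\row_j (complex.Complex 0 (b j) * cis (t * b j))) *m adjmx V.
Proof.
apply/matrixP => i k; have [d1 d2] := cder_dpath V b t i k.
rewrite [LHS]mxE !derive1E (@derive_val _ _ _ _ _ _ _ d1) (@derive_val _ _ _ _ _ _ _ d2).
by case: (_ i k).
Qed.

Lemma is_C1_dpath V b : is_C1 (dpath V b).
Proof.
move=> i k; have d t := cder_dpath V b t i k.
have cd : ccontin setT (fun t => mderiv (dpath V b) t i k).
  have : mcontin setT (fun t => mderiv (dpath V b) t); last by move=> h x Ax; exact: h.
  under eq_fun do rewrite mderiv_dpath.
  apply: mcontinM; last exact: mcontin_cst.
  apply: mcontinM; first exact: mcontin_cst.
  apply: (@mcontin_diag R R setT n (fun j (t : R) => complex.Complex 0 (b j) * cis (t * b j))) => j.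
  apply: ccontinM; first exact: ccontin_cst.
  by apply: ccontin_cis; exact: rcontin_idM.
split; first by move=> t; case: (d t) => d1 _; exact: ex_derive.
split; first by move=> t; case: (d t) => _ d2; exact: ex_derive.
have -> : (fun s => re (dpath V b s i k))^`() = (fun t => re (mderiv (dpath V b) t i k)).
  by apply/funext => t; rewrite mxE.
have -> : (fun s => im (dpath V b s i k))^`() = (fun t => im (mderiv (dpath V b) t i k)).
  by apply/funext => t; rewrite mxE.
by split; apply: rcontin_setT; [exact: rcontin_Re cd|exact: rcontin_Im cd].
Qed.

(** The phases of the derivative and of the adjoint cancel, leaving the constant matrix $B$;
    nonnegative angles therefore make [dpath V b] itself a positive representative. *)
Lemma hgen_dpath V b t : unitary V ->
  hgen (dpath V b) t = V *m diag_mx (\row_j complex.Complex (b j) 0) *m adjmx V.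
Proof.
move=> UV; rewrite /hgen mderiv_dpath.
have -> : adjmx (dpath V b t) = V *m cisdiag (fun j => - (t * b j)) *m adjmx V.
  by rewrite /dpath !adjmxM adjmxK cisdiagN mulmxA.
rewrite conj_diagM // conj_diagZ; congr (_ *m diag_mx _ *m _); apply/rowP => j.
rewrite !mxE -mulrA -cisD subrr cis0 mulr1.
by congr complex.Complex => /=; ring.
Qed.

(** In the coordinates [x = adjmx V *m v] the form is $\sum_j b_j |x_j|^2$. *)
Lemma psd_conj_diag V (b : 'I_n -> R) : (forall j, 0 <= b j) ->
  psd (V *m diag_mx (\row_j complex.Complex (b j) 0) *m adjmx V).
Proof.
move=> b0; set D := diag_mx _.
have DD : adjmx D = D.
  rewrite /adjmx map_diag_mx tr_diag_mx; congr diag_mx; apply/rowP => j.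
  by rewrite !mxE /= oppr0.
split; first by rewrite /Defs.hermitian !adjmxM adjmxK DD mulmxA.
move=> v; have -> : adjmx v *m (V *m D *m adjmx V) *m v =
    adjmx (adjmx V *m v) *m D *m (adjmx V *m v).
  by rewrite adjmxM adjmxK !mulmxA.
set x := adjmx V *m v; rewrite mul_mx_diag mxE; apply: sumr_ge0 => j _; rewrite [X in X * _]mxE.
have x_ge0 : 0 <= complex.conjc (x j 0) * x j 0 :> C.
  by case: (x j 0) => p q; rewrite lecE /=; apply/andP; split; [apply/eqP; ring|nra].
have b_ge0 : 0 <= complex.Complex (b j) 0 :> C by rewrite lecE /= eqxx b0.
have -> : (adjmx x) 0 j * (\row_k complex.Complex (b k) 0) 0 j * x j 0 =
    complex.conjc (x j 0) * x j 0 * complex.Complex (b j) 0.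
  by rewrite /adjmx 3!mxE mulrAC.
exact: mulr_ge0.
Qed.

End Monotone.

(** * Comparison of powers through winding numbers, and the limit *)

Section Growth.
Variables (R : realType) (n : nat).
Local Notation C := (complex.complex R).
Local Notation I := (@I01 R).
Implicit Types (u v f g : mpath R n).

Lemma det_lift_pmul u v a b : det_lift u a -> det_lift v b ->
  det_lift (pmul u v) (fun t => a t + b t).
Proof.
move=> /det_liftP[ca ha] /det_liftP[cb hb]; apply/det_liftP; split.
  exact: rcontinD.
by move=> t It; rewrite /pmul det_mulmx ha // hb // cisD.
Qed.

Lemma det_lift_pinv u a : det_lift u a -> det_lift (Defs.pinv u) (fun t => - a t).
Proof.
move=> /det_liftP[ca ha]; apply/det_liftP; split; first exact: rcontinN.
by move=> t It; rewrite /Defs.pinv det_adjmx ha // cisN.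
Qed.

Lemma det_mxnpow (A : 'M[C]_n) k : \det (mxnpow A k) = \det A ^+ k.
Proof.
elim: k => [|k IH]; first by rewrite det1.
by rewrite /mxnpow /= det_mulmx -/(mxnpow A k) IH exprS.
Qed.

Lemma det_lift_ppow u a p : det_lift u a -> det_lift (ppow u p) (fun t => p%:~R * a t).
Proof.
move=> /det_liftP[ca ha]; apply/det_liftP; split.
  by apply: rcontinM => //; exact: rcontin_cst.
move=> t It; case: p => k.
  by rewrite /ppow det_mxnpow ha // -cisX -mulr_natl.
rewrite /ppow det_mxnpow det_adjmx ha // NegzE mulrNz mulNr cisN.
by rewrite -rmorphXn /= -cisX -mulr_natl.
Qed.

Lemma is_path_ppow u (k : nat) : is_path u -> is_path (ppow u k).
Proof.
move=> pu; elim: k => [|k IH].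
  apply/is_pathP; split => //; first by move=> t _; exact: unitary1.
  exact: mcontin_cst.
by have := is_pathM pu IH.
Qed.

(** The exponent [p] is an arbitrary integer, because [is_gamma_n] compares with all integer
    exponents. *)
Lemma geq_index f g thf thg p (k : nat) : det_lift f thf -> det_lift g thg ->
  Defs.geq (ppow f p) (ppow g k) ->
  k%:R * (thg 1 - thg 0) <= p%:~R * (thf 1 - thf 0).
Proof.
move=> lf lg [w [hw [cw pw]]].
have lfg := det_lift_pmul (det_lift_ppow p lf) (det_lift_pinv (det_lift_ppow k lg)).
have [th lw e] := homotopic_det_lift hw lfg.
have /is_pathP[_ uw _] := homotopic_path_r hw.
have := det_lift_nondecreasing cw uw lw pw.
by move: e; rewrite -pmulrn; lra.
Qed.

Lemma index_gt0 f th : (0 < n)%N -> dominant f -> det_lift f th -> th 0 < th 1.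
Proof.
move=> n0 [w [hw [cw pw]]] lf.
have [th' lw e] := homotopic_det_lift hw lf.
have /is_pathP[_ uw _] := homotopic_path_r hw.
by rewrite -subr_gt0 -e subr_gt0; exact: det_lift_increasing pw.
Qed.

(** The normal form has the explicit determinant lift $t \mapsto t \sum_j b_j$, so its angle sum is
    the winding number of [u], and the hypothesis on [th] becomes the one under which the angles can
    be made nonnegative. *)
Lemma nonneg_of_index u th : (0 < n)%N -> is_path u -> det_lift u th ->
  pi *+ 2 * n%:R <= th 1 - th 0 -> nonneg u.
Proof.
move=> n0 pu lu hth; have [V [b [UV hub]]] := homotopic_dpath (Ordinal n0) pu.
have sb : th 1 - th 0 = \sum_j b j.
  have [th' lw <-] := homotopic_det_lift hub lu.
  rewrite (@det_lift_unique _ _ (dpath V b) th' (fun t => t * \sum_j b j)) //.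
    by rewrite mul1r mul0r subr0.
  apply/det_liftP; split; first exact: rcontin_idM.
  by move=> t _; exact: det_dpath.
rewrite sb in hth.
have [b' [b0 hbb]] := homotopic_dpath_ge0 (Ordinal n0) UV hth.
exists (dpath V b'); split; first exact: homotopic_trans hub hbb.
split; first exact: is_C1_dpath.
by move=> t _; rewrite hgen_dpath //; exact: psd_conj_diag.
Qed.

Lemma geq_of_index f g thf thg (p k : nat) : (0 < n)%N -> is_path f -> is_path g ->
  det_lift f thf -> det_lift g thg ->
  pi *+ 2 * n%:R <= p%:R * (thf 1 - thf 0) - k%:R * (thg 1 - thg 0) ->
  Defs.geq (ppow f p) (ppow g k).
Proof.
move=> n0 pf pg lf lg h.
have lfg := det_lift_pmul (det_lift_ppow p lf) (det_lift_pinv (det_lift_ppow k lg)).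
apply: (nonneg_of_index n0 _ lfg).
  by apply: is_pathM; [exact: is_path_ppow|apply: is_pathV; exact: is_path_ppow].
by apply: le_trans h _; rewrite -!pmulrn; lra.
Qed.

End Growth.

Theorem mainTheorem4 (R : realType) (n : nat) (f g : mpath R n) :
  is_path f -> is_path g ->
  dominant f -> dominant g ->
  ~ homotopic f (@const_path R n) -> ~ homotopic g (@const_path R n) ->
  forall thf thg : R -> R, det_lift f thf -> det_lift g thg ->
  exists gam : nat -> int,
    (forall k : nat, (0 < k)%N -> is_gamma_n f g k (gam k)) /\
    ((fun k : nat => (gam k)%:~R / k%:R : R) @ \oo -->
       (thg 1 - thg 0) / (thf 1 - thf 0)).
Proof.
move=> pf pg df dg nf _ thf thg lf lg.
(* In dimension 0 every path is constant; non-constancy of [f] excludes this case, in which the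
   winding numbers would vanish. *)
have n0 : (0 < n)%N.
  case: n f pf nf {g pg df dg lf lg} => // f pf []; apply: eq_homotopic => // t _.
  by apply/matrixP => -[].
have := index_gt0 n0 df lf; have := index_gt0 n0 dg lg.
rewrite -subr_gt0 => mg0; rewrite -subr_gt0 => mf0.
have low := fun p k => @geq_index R n f g thf thg p k lf lg.
have upp := fun p k => @geq_of_index R n f g thf thg p k n0 pf pg lf lg.
move: (thg 1 - thg 0) (thf 1 - thf 0) mg0 mf0 low upp => mg mf mg0 mf0 low upp.
(* The first summand is the gap $2\pi n$ between the two criteria, measured in powers of [f]; the 1
   accounts for rounding up to an integer exponent. *)
pose B : R := pi *+ 2 * n%:R / mf + 1.
have B0 : 0 <= B.
  by rewrite addr_ge0 // divr_ge0 ?(ltW mf0) // mulr_ge0 // mulrn_wge0 // pi_ge0.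
have /choice[gam hgam] : forall k : nat, exists p : int, (0 < k)%N ->
    is_gamma_n f g k p /\
    k%:R * mg / mf <= p%:~R <= k%:R * mg / mf + B.
  move=> k.
  (* The value of [gam] at 0 is arbitrary: [is_gamma_n] is asserted for positive [k] only. *)
  have [->|k0] := posnP k; first by exists 0.
  (* The real exponent that meets the threshold $2\pi n$ exactly; the natural number just above it
     is an admissible exponent. *)
  pose x := k%:R * mg / mf + pi *+ 2 * n%:R / mf.
  have x0 : 0 <= x.
    rewrite addr_ge0 // divr_ge0 ?(ltW mf0) ?mulr_ge0 ?(ltW mg0) //.
    by rewrite mulrn_wge0 // pi_ge0.
  have /andP[tx xt] := truncn_itv x0.
  have ex : exists m : nat, `[< Defs.geq (ppow f m) (ppow g k) >].
    exists (Num.truncn x).+1; apply/asboolP/upp.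
    rewrite lerBrDr -ler_pdivrMr // mulrDl [leLHS]addrC; exact: ltW.
  pose m := ex_minn ex; exists m => _.
  have [/asboolP gm min_m] : `[< Defs.geq (ppow f m) (ppow g k) >] /\
      forall q : nat, `[< Defs.geq (ppow f q) (ppow g k) >] -> (m <= q)%N.
    by rewrite /m; case: ex_minnP.
  split.
    (* A negative exponent would make the lower bound $k\mu(g)$ negative, so the least natural
       exponent is also the least integer one. *)
    split => // -[q|q] gq; first by rewrite lez_nat; apply: min_m; exact/asboolP.
    have := low _ _ gq; rewrite leNgt NegzE mulrNz mulNr.
    rewrite (lt_trans (_ : _ < 0)) //; first by rewrite oppr_lt0 mulr_gt0 // ltr0n.
    by rewrite mulr_gt0 // ltr0n.
  apply/andP; split; first by rewrite ler_pdivrMr //; exact: low.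
  have mt : (m <= (Num.truncn x).+1)%N.
    apply: min_m; apply/asboolP/upp.
    rewrite lerBrDr -ler_pdivrMr // mulrDl [leLHS]addrC; exact: ltW.
  rewrite -pmulrn; apply: (@le_trans _ _ ((Num.truncn x).+1%:R)).
    by rewrite ler_nat.
  by rewrite /B addrA -natr1 lerD2r.
exists gam; split; first by move=> k /hgam[].
(* [harmonic k] is $1/(k+1)$; the factor 2 comes from $1/k \le 2/(k+1)$ for $k \ge 1$. *)
apply: (@squeeze_cvgr _ _ _ _ (fun=> mg / mf) (fun k => mg / mf + (B *+ 2) * harmonic k)).
- near=> k; have k0 : (0 < k)%N by near: k; exact: nbhs_infty_gt.
  have [_ /andP[h1 h2]] := hgam k k0; have k0' : 0 < k%:R :> R by rewrite ltr0n.
  apply/andP; split; first by rewrite ler_pdivlMr // mulrC mulrA.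
  rewrite ler_pdivrMr //; apply: le_trans h2 _.
  rewrite mulrDl lerD //; first by rewrite [leRHS]mulrC mulrA.
  rewrite /harmonic /= -mulrA -[leLHS]mulr1 mulrnAl -mulrnAr ler_wpM2l //.
  rewrite -mulr_natl mulrA mulrAC ler_pdivlMr ?ltr0n // mul1r -natrM ler_nat.
  by rewrite mul2n -addnn -addn1 leq_add2l.
- exact: cvg_cst.
- rewrite -[X in _ --> X]addr0; apply: cvgD; first exact: cvg_cst.
  rewrite -[X in _ --> X](mulr0 (B *+ 2)); apply: cvgM; first exact: cvg_cst.
  exact: cvg_harmonic.
Unshelve. all: by end_near.
Qed.
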